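(* Let $X$ be a Banach space over the real or complex field $\mathbb{F}$ and let $\mathcal{B}(X)$ be the algebra of all bounded linear operators on $X$. Then every commuting trace of an arbitrary bilinear mapping on $\mathcal{B}(X)$ is proper: for every $\mathbb{F}$-bilinear $\mathfrak{q}\colon\mathcal{B}(X)\times\mathcal{B}(X)\to\mathcal{B}(X)$ with $[\mathfrak{q}(x,x),x]=0$ for all $x\in\mathcal{B}(X)$, there exist $z\in\mathcal{Z}(\mathcal{B}(X))$, an $\mathbb{F}$-linear mapping $\mu\colon\mathcal{B}(X)\to\mathcal{Z}(\mathcal{B}(X))$ and a trace $\nu$ of some $\mathbb{F}$-bilinear mapping $\mathcal{B}(X)\times\mathcal{B}(X)\to\mathcal{Z}(\mathcal{B}(X))$ such that $\mathfrak{q}(x,x)=zx^2+\mu(x)x+\nu(x)$ for all $x\in\mathcal{B}(X)$.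
   Context: $\mathcal{Z}(\cdot)$ denotes the center and $[x,y]=xy-yx$. The trace of a bilinear mapping $\mathfrak{q}$ is the map $x\mapsto\mathfrak{q}(x,x)$. No continuity is assumed of the (bi)linear mappings. *)

(* Defs.v *)
From HB Require Import structures.
From mathcomp Require Import all_boot all_order all_algebra.
From mathcomp Require Import all_classical all_reals all_analysis.
From mathcomp Require Export complex.

Set Implicit Arguments.
Unset Strict Implicit.
Unset Printing Implicit Defensive.

Import Order.TTheory GRing.Theory Num.Theory.
Import numFieldNormedType.Exports.

Local Open Scope classical_set_scope.
Local Open Scope ring_scope.

Section BoundedOperators.
Variables (K : numFieldType) (X : normedModType K).

Definition bounded_operator : {pred X -> X} :=
  fun T => `[< linear T /\ exists M : K, forall x, `|T x| <= M * `|x| >].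

Lemma bounded_operatorP (T : X -> X) :
  reflect (linear T /\ exists M : K, forall x, `|T x| <= M * `|x|)
          (T \in bounded_operator).
Proof. exact: asboolP. Qed.

(* The constant in the bound may be taken nonnegative, also when it ranges over
   a field such as R[i] whose order is only partial. *)
Lemma bounded_operator_ge0 (T : X -> X) : T \in bounded_operator ->
  exists2 M : K, 0 <= M & forall x, `|T x| <= M * `|x|.
Proof.
move=> /bounded_operatorP[_ [M TM]].
have [[x x0]|X0] := pselect (exists x : X, x != 0).
  exists M => //; rewrite -(@pmulr_lge0 _ `|x|) ?normr_gt0//.
  exact: le_trans (TM x).
exists 0 => // x; have -> : x = 0.
  by apply: contrapT => /eqP x0; apply: X0; exists x.
by have := TM 0; rewrite normr0 !mulr0.
Qed.

(* For linear maps this agrees with the notions of boundedness and continuity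
   of the library. *)
Lemma bounded_operator_bounded_near (T : {linear X -> X}) :
  (T : X -> X) \in bounded_operator <-> bounded_near T (nbhs (0 : X)).
Proof.
split=> [/bounded_operator_ge0[M M0 TM]|].
  apply/linear_boundedP; exists M; split; first exact: ger0_real.
  move=> r Mr x; apply: le_trans (TM x) _.
  by rewrite ler_wpM2r// ltW.
move=> /linear_boundedP[M [Mreal TM]]; apply/bounded_operatorP.
split; first exact: linearP.
by exists (M + 1) => x; apply: TM; rewrite ltrDl.
Qed.

Lemma bounded_operator_continuous (T : {linear X -> X}) :
  (T : X -> X) \in bounded_operator <-> continuous T.
Proof.
rewrite bounded_operator_bounded_near; exact: linear_bounded_continuous.
Qed.

Fact bounded_operator_submod : subsemimod_closed bounded_operator.
Proof.
split; first split.
- apply/bounded_operatorP; split=> [a x y|].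
    by rewrite [RHS]addr0 scaler0.
  by exists 0 => x; rewrite mul0r normr0.
- move=> S T Sb Tb.
  have [/bounded_operatorP[Sl _] /bounded_operatorP[Tl _]] := (Sb, Tb).
  have [M M0 SM] := bounded_operator_ge0 Sb.
  have [N N0 TN] := bounded_operator_ge0 Tb.
  apply/bounded_operatorP; split=> [a x y|].
    rewrite [LHS](_ : _ = S (a *: x + y) + T (a *: x + y))//.
    by rewrite Sl Tl addrACA -scalerDr.
  exists (M + N) => x; rewrite mulrDl.
  by apply: le_trans (ler_normD _ _) _; exact: lerD.
- move=> a T Tb; have /bounded_operatorP[Tl _] := Tb.
  have [M M0 TM] := bounded_operator_ge0 Tb.
  apply/bounded_operatorP; split=> [b x y|].
    by rewrite [LHS](_ : _ = a *: T (b *: x + y))// Tl scalerDr !scalerA mulrC.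
  exists (`|a| * M) => x; rewrite normrZ -mulrA.
  exact: ler_wpM2l.
Qed.

HB.instance Definition _ :=
  GRing.isSubmodClosed.Build K (X -> X) bounded_operator
    bounded_operator_submod.

Record boundedOp := BoundedOp { bop_fun :> X -> X; bop_funP : bop_fun \in bounded_operator }.

HB.instance Definition _ := [isSub for bop_fun].
HB.instance Definition _ := [Choice of boundedOp by <:].
HB.instance Definition _ := [SubChoice_isSubZmodule of boundedOp by <:].
HB.instance Definition _ := [SubZmodule_isSubLmodule of boundedOp by <:].

Lemma bop_linear (T : boundedOp) : linear T.
Proof. by case: T => T /= /bounded_operatorP[]. Qed.

Lemma bop_ext (S T : boundedOp) : S =1 T -> S = T.
Proof. by move=> ST; apply: val_inj; apply/funext. Qed.

Fact id_bounded_operator : (fun x : X => x) \in bounded_operator.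
Proof.
by apply/bounded_operatorP; split=> //; exists 1 => x; rewrite mul1r.
Qed.

Fact comp_bounded_operator (S T : boundedOp) : (S \o T) \in bounded_operator.
Proof.
have [M M0 SM] := bounded_operator_ge0 (bop_funP S).
have [N N0 TN] := bounded_operator_ge0 (bop_funP T).
apply/bounded_operatorP; split=> [a x y|]; first by rewrite /= !bop_linear.
exists (M * N) => x; apply: le_trans (SM _) _.
by rewrite -mulrA ler_wpM2l.
Qed.

Definition bop_one : boundedOp := BoundedOp id_bounded_operator.
Definition bop_mul (S T : boundedOp) : boundedOp := BoundedOp (comp_bounded_operator S T).

Fact bop_mulA : associative bop_mul.
Proof. by move=> S T U; exact: bop_ext. Qed.
Fact bop_mul1r : left_id bop_one bop_mul.
Proof. by move=> T; exact: bop_ext. Qed.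
Fact bop_mulr1 : right_id bop_one bop_mul.
Proof. by move=> T; exact: bop_ext. Qed.
Fact bop_mulDl : left_distributive bop_mul +%R.
Proof. by move=> S T U; exact: bop_ext. Qed.
Fact bop_mulDr : right_distributive bop_mul +%R.
Proof.
move=> S T U; apply: bop_ext => x.
by have := bop_linear S 1 (T x) (U x); rewrite !scale1r.
Qed.

(* Only a pzRingType: for X = 0 this is the trivial ring. *)
HB.instance Definition _ := GRing.Zmodule_isPzRing.Build boundedOp
  bop_mulA bop_mul1r bop_mulr1 bop_mulDl bop_mulDr.

Lemma bop_addE (S T : boundedOp) x : (S + T) x = S x + T x. Proof. by []. Qed.
Lemma bop_scaleE (a : K) (T : boundedOp) x : (a *: T) x = a *: T x. Proof. by []. Qed.
Lemma bop_oneE x : (1 : boundedOp) x = x. Proof. by []. Qed.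
Lemma bop_mulE (S T : boundedOp) x : (S * T) x = S (T x). Proof. by []. Qed.

Lemma bop_scalerAl (a : K) (S T : boundedOp) : a *: (S * T) = (a *: S) * T.
Proof. exact: bop_ext. Qed.
Lemma bop_scalerAr (a : K) (S T : boundedOp) : a *: (S * T) = S * (a *: T).
Proof.
apply: bop_ext => x; rewrite bop_scaleE !bop_mulE bop_scaleE.
have := bop_linear S a (T x) 0; rewrite addr0 => ->.
have := bop_linear S (-1) 0 0.
by rewrite !scaleN1r oppr0 addr0 addNr => ->; rewrite addr0.
Qed.

End BoundedOperators.

Definition commutator (A : pzRingType) (x y : A) : A := x * y - y * x.

Definition center (A : pzRingType) : {pred A} :=
  fun z => `[< forall y : A, z * y = y * z >].
Arguments center A : clear implicits.

Definition trace (U V : Type) (q : U -> U -> V) : U -> V := fun x => q x x.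

Definition commuting (A : pzRingType) (f : A -> A) : Prop :=
  forall x : A, commutator (f x) x = 0.

Definition proper_trace (K : numFieldType) (X : normedModType K)
    (f : boundedOp X -> boundedOp X) : Prop :=
  exists z : boundedOp X, exists mu : {linear boundedOp X -> boundedOp X},
  exists p : {bilinear boundedOp X -> boundedOp X -> boundedOp X},
    [/\ z \in center (boundedOp X),
        forall x, mu x \in center (boundedOp X),
        forall x y, p x y \in center (boundedOp X)
      & forall x, f x = z * x ^+ 2 + mu x * x + trace p x].

(* Main.v *)
(* Write [B x y = q x y + q y x] and work with rank one operators
   [r = u (x) f] and modulo scalars.  Polarising [q x x * x = x * q x x] gives
   [[B x y, x] + [q x x, y] = 0] and [[B x y, z] + [B y z, x] + [B z x, y] = 0].
   - The first identity forces [q r r = d r] modulo scalars; [d(u, f)] is then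
     bilinear, and [C r s = B r s - d(r) s - d(s) r] commutes with [r] and [s]
     and is alternating in the vectors and in the functionals.
   - If [dim X = 2] this makes [C] scalar.  If [dim X >= 3] the second identity
     shows that [C r s] is proportional to [r s + s r - tr r s - tr s r], with a
     factor [l] that does not depend on [r] and [s] because both sides are
     multilinear.
   - Hence [B r s = l (r s + s r) + m(r) s + m(s) r], and for arbitrary [x] the
     operator [B x r - l (x r + r x) - m(r) x] is [t(x) r] modulo scalars.  Then
     [q x x - l x^2 - t(x) x] commutes with every rank one operator.
   If [dim X <= 1] the algebra is commutative.  Functionals separating the points
   of [X] come from the Hahn-Banach theorem, proved with minimal sublinear
   functionals. *)

Require Import Defs.
From HB Require Import structures.
From mathcomp Require Import all_boot all_order all_algebra.
From mathcomp Require Import all_classical all_reals all_analysis.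
From mathcomp Require Import complex.
From mathcomp Require Import ring lra.

Set Implicit Arguments.
Unset Strict Implicit.
Unset Printing Implicit Defensive.

Import Order.TTheory GRing.Theory Num.Theory.
Import numFieldNormedType.Exports.
Local Open Scope ring_scope.

(** * The Hahn-Banach theorem *)

Section HahnBanach.
Local Open Scope classical_set_scope.
(* [K] is [R] or [R[i]]; only the scalars in the image of [iota] are used. *)
Variables (R : realType) (K : numFieldType) (iota : {rmorphism R -> K}).
Variable V : lmodType K.

Definition sublinear (q : V -> R) :=
  (forall x y, q (x + y) <= q x + q y) /\
  (forall (t : R) x, 0 <= t -> q (iota t *: x) = t * q x).

Lemma sublinear0 q : sublinear q -> q 0 = 0.
Proof. by case=> _ /(_ 0 0 (lexx _)); rewrite scaler0 mul0r. Qed.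

Lemma sublinear_ge q x : sublinear q -> - q (- x) <= q x.
Proof.
move=> sq; have := sq.1 x (- x); rewrite subrr sublinear0// => ?.
by rewrite -subr_ge0 opprK.
Qed.

(** Subadditivity and homogeneity are asked of the family as a whole, with a third member allowed on
    the left, so that the lemma covers both translates of one functional and chains. The bound [b]
    keeps the infimum finite. *)
Lemma inf_sublinear (F : set (V -> R)) (b : V -> R) :
  F !=set0 ->
  (forall q x, F q -> b x <= q x) ->
  (forall q, F q -> q 0 = 0) ->
  (forall q1 q2 x y, F q1 -> F q2 ->
    exists2 q3, F q3 & q3 (x + y) <= q1 x + q2 y) ->
  (forall q (t : R) x, F q -> 0 < t -> exists2 q3, F q3 & q3 (iota t *: x) <= t * q x) ->
  sublinear (fun x => inf [set q x | q in F]) /\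
  forall q x, F q -> inf [set q x | q in F] <= q x.
Proof.
move=> [q0 Fq0] Fb F0 FD FZ; pose s x := inf [set q x | q in F].
have s_lb x : lbound [set q x | q in F] (b x) by move=> _ [q Fq <-]; exact: Fb.
have s_le q x : F q -> s x <= q x.
  by move=> Fq; apply: ge_inf; [exists (b x) | exists q].
have s_ge x c : (forall q, F q -> c <= q x) -> c <= s x.
  move=> Fc; apply: lb_le_inf; first by exists (q0 x), q0.
  by move=> _ [q Fq <-]; exact: Fc.
have sZ_le t x : 0 < t -> s (iota t *: x) <= t * s x.
  move=> t0; rewrite mulrC -ler_pdivrMr//; apply: (s_ge) => q Fq.
  rewrite ler_pdivrMr// mulrC; have [q3 Fq3 le_q3] := FZ q t x Fq t0.
  exact: le_trans (s_le _ _ Fq3) _.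
split; last by move=> q x; exact: s_le.
split=> [x y|t x]; rewrite -!/(s _).
  rewrite -lerBlDr; apply: (s_ge) => q1 Fq1.
  rewrite lerBlDr -lerBlDl; apply: (s_ge) => q2 Fq2; rewrite lerBlDl.
  have [q3 Fq3 le_q3] := FD q1 q2 x y Fq1 Fq2.
  exact: le_trans (s_le _ _ Fq3) _.
rewrite le_eqVlt => /predU1P[<-|t0].
  rewrite rmorph0 scale0r mul0r; apply/eqP; rewrite eq_le; apply/andP; split.
    by rewrite (le_trans (s_le q0 _ Fq0))// F0.
  by apply: (s_ge) => q Fq; rewrite F0.
(* The reverse inequality is [sZ_le] for the factor [t^-1] at the point [iota t *: x]. *)
apply/eqP; rewrite eq_le sZ_le//= mulrC -ler_pdivlMr// mulrC.
have tV0 : 0 < t^-1 by rewrite invr_gt0.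
apply: le_trans (sZ_le _ (iota t *: x) tV0).
by rewrite scalerA -rmorphM mulVf ?gt_eqF// rmorph1 scale1r.
Qed.

(* The sublinear functional below [q] that is tight along the half-line
   spanned by [x0]; if [q] is minimal it equals [q], which is then additive. *)
Lemma sublinear_descent q x0 : sublinear q ->
  exists s, [/\ sublinear s, forall x, s x <= q x &
    forall x, s x <= q (x + x0) - q x0].
Proof.
move=> sq; have [qD qZ] := sq.
pose F := [set f : V -> R | exists2 t : R, 0 <= t &
  f = fun x => q (x + iota t *: x0) - t * q x0].
have F0 : F q.
  by exists 0 => //; apply/funext => x; rewrite rmorph0 scale0r addr0 mul0r subr0.
have F1 : F (fun x => q (x + x0) - q x0).
  by exists 1 => //; apply/funext => x; rewrite rmorph1 scale1r mul1r.
(* The lower bound comes from [t * q x0 = q (iota t *: x0) <= q (x + iota t *: x0) + q (- x)]. *)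
have [|||||s_sub s_le] := @inf_sublinear F (fun x => - q (- x)).
- by exists q.
- move=> _ x [t t0 ->]; have := qD (x + iota t *: x0) (- x).
  by rewrite addrAC subrr add0r qZ//; lra.
- by move=> _ [t t0 ->]; rewrite add0r qZ// subrr.
- move=> _ _ x y [t t0 ->] [u u0 ->].
  exists (fun x => q (x + iota (t + u) *: x0) - (t + u) * q x0).
    by exists (t + u) => //; exact: addr_ge0.
  have := qD (x + iota t *: x0) (y + iota u *: x0).
  by rewrite addrACA -scalerDl -rmorphD; lra.
- move=> _ t x [u u0 ->] t0.
  exists (fun x => q (x + iota (t * u) *: x0) - (t * u) * q x0).
    by exists (t * u) => //; exact: mulr_ge0 (ltW t0) u0.
  by rewrite rmorphM -scalerA -scalerDr (qZ _ _ (ltW t0)) mulrBr mulrA.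
exists (fun x => inf [set f x | f in F]); split=> // x; first exact: s_le.
by have := s_le _ x F1.
Qed.

(** Zorn's lemma for the reversed pointwise order. A chain is bounded by its pointwise infimum,
    which is subadditive because two members can be replaced by the smaller one. *)
Lemma minimal_sublinear p : sublinear p ->
  exists q, [/\ sublinear q, forall x, q x <= p x &
    forall s, sublinear s -> (forall x, s x <= q x) -> s = q].
Proof.
move=> sp.
pose T := {q : V -> R | sublinear q /\ forall x, q x <= p x}.
pose le_op (q s : T) := `[< forall x, sval s x <= sval q x >].
have [||||[q [sq qp]] qmin] := @Zorn T le_op.
- by move=> q; apply/asboolP.
- move=> q r s /asboolP qr /asboolP rs; apply/asboolP => x.
  exact: le_trans (rs x) (qr x).
- move=> [q qP] [s sP] /asboolP /= qs /asboolP /= sq; apply: eq_exist.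
  by apply/funext => x; apply/eqP; rewrite eq_le qs sq.
- move=> A totA; have [[a Aa]|A0] := pselect (A !=set0); last first.
    by exists (exist _ p (conj sp (fun x => lexx _))) => s As; case: A0; exists s.
  pose F := [set sval r | r in A].
  (* For a fixed member [a], every [r] in the chain satisfies [- a (- x) <= r x]: if [r] is below
     [a], through [- r (- x)], otherwise through [a x]. *)
  have [|||||s_sub s_le] := @inf_sublinear F (fun x => - sval a (- x)).
  + by exists (sval a), a.
  + move=> _ x [r Ar <-]; have [sr rp] := svalP r; have [sa ap] := svalP a.
    have := sublinear_ge x sr; have := sublinear_ge x sa.
    have [] := totA _ _ Aa Ar => /asboolP le_ar.
      by have := le_ar (- x); lra.
    by have := le_ar x; lra.
  + by move=> _ [r Ar <-]; exact: sublinear0 (svalP r).1.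
  + move=> _ _ x y [r Ar <-] [s As <-].
    have [] := totA _ _ Ar As => /asboolP le_rs.
      exists (sval s); first by exists s.
      by have := (svalP s).1.1 x y; have := le_rs x; lra.
    exists (sval r); first by exists r.
    by have := (svalP r).1.1 x y; have := le_rs y; lra.
  + move=> _ t x [r Ar <-] t0; exists (sval r); first by exists r.
    by rewrite ((svalP r).1.2 _ _ (ltW t0)).
  have sP : sublinear (fun x => inf [set f x | f in F]) /\
      forall x, inf [set f x | f in F] <= p x.
    split=> // x; apply: le_trans (s_le (sval a) x _) ((svalP a).2 x).
    by exists a.
  exists (exist (fun q => sublinear q /\ forall x, q x <= p x) _ sP) => r Ar.
  apply/asboolP => x /=.
  by apply: s_le; exists r.
exists q; split=> // s ss le_sq.
have sp' : sublinear s /\ forall x, s x <= p x.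
  by split=> // x; exact: le_trans (qp x).
pose s' : T := exist (fun q => sublinear q /\ forall x, q x <= p x) s sp'.
by have /(_ _)/(congr1 sval)/= -> := qmin s'; last exact/asboolP.
Qed.

(** Descend along [x0] first, then take a minimal functional [f]. Descending from [f] along any [y]
    gives [f] back, whence [f x <= f (x + y) - f y] and additivity. The first descent forces
    [f (- x0) <= - p x0], hence equality at [x0]. *)
Lemma hahn_banach_sublinear p x0 : sublinear p ->
  exists f : V -> R, [/\ forall x y, f (x + y) = f x + f y,
    forall (t : R) x, f (iota t *: x) = t * f x,
    forall x, f x <= p x & f x0 = p x0].
Proof.
move=> sp; have [p' [sp' le_p'p p'_x0]] := sublinear_descent x0 sp.
have [f [sf le_fp' fmin]] := minimal_sublinear sp'.
have fD x y : f (x + y) = f x + f y.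
  apply/eqP; rewrite eq_le sf.1/=.
  have [s [ss le_sf s_y]] := sublinear_descent y sf.
  by have := s_y x; rewrite (fmin _ ss le_sf) lerBrDr.
have f0 : f 0 = 0 := sublinear0 sf.
have fN x : f (- x) = - f x.
  by apply/eqP; rewrite -subr_eq0 opprK -fD addNr f0.
exists f; split=> // [t x|x|].
- have [t0|/ltW t0] := leP 0 t; first exact: sf.2.
  rewrite -[t]opprK rmorphN scaleNr fN sf.2 ?oppr_ge0//.
  by rewrite !mulNr.
- exact: le_trans (le_fp' x) _.
apply/eqP; rewrite eq_le (le_trans (le_fp' x0))//=.
have := p'_x0 (- x0); have := le_fp' (- x0).
by rewrite addNr (sublinear0 sp) fN; lra.
Qed.

End HahnBanach.

(** * Bounded linear functionals *)

Section Dual.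
Variables (K : numFieldType) (X : normedModType K).

Definition bounded_functional : {pred X -> K^o} :=
  fun f => `[< linear f /\ exists2 M : K, 0 <= M & forall x, `|f x| <= M * `|x| >].

Lemma bounded_functionalP (f : X -> K^o) :
  reflect (linear f /\ exists2 M : K, 0 <= M & forall x, `|f x| <= M * `|x|)
          (f \in bounded_functional).
Proof. exact: asboolP. Qed.

Fact bounded_functional_submod : subsemimod_closed bounded_functional.
Proof.
split; first split.
- apply/bounded_functionalP; split=> [a x y|].
    by rewrite [RHS]addr0 scaler0.
  by exists 0 => // x; rewrite mul0r normr0.
- move=> f g /bounded_functionalP[fl [M M0 fM]] /bounded_functionalP[gl [N N0 gN]].
  apply/bounded_functionalP; split=> [a x y|].
    rewrite [LHS](_ : _ = f (a *: x + y) + g (a *: x + y))//.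
    by rewrite fl gl addrACA -scalerDr.
  exists (M + N) => [|x]; first exact: addr_ge0.
  by rewrite mulrDl; apply: le_trans (ler_normD _ _) _; exact: lerD.
- move=> a f /bounded_functionalP[fl [M M0 fM]].
  apply/bounded_functionalP; split=> [b x y|].
    by rewrite [LHS](_ : _ = a *: f (b *: x + y))// fl scalerDr !scalerA mulrC.
  exists (`|a| * M) => [|x]; first exact: mulr_ge0.
  by rewrite [`|_ x|](normrM a (f x)) -mulrA; exact: ler_wpM2l.
Qed.

HB.instance Definition _ :=
  GRing.isSubmodClosed.Build K (X -> K^o) bounded_functional
    bounded_functional_submod.

Record dual := Dual { dual_fun :> X -> K^o; dual_funP : dual_fun \in bounded_functional }.

HB.instance Definition _ := [isSub for dual_fun].
HB.instance Definition _ := [Choice of dual by <:].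
HB.instance Definition _ := [SubChoice_isSubZmodule of dual by <:].
HB.instance Definition _ := [SubZmodule_isSubLmodule of dual by <:].

Lemma dual_ext (f g : dual) : f =1 g -> f = g.
Proof. by move=> fg; apply: val_inj; apply/funext. Qed.

Lemma dual_linear (f : dual) : linear f.
Proof. by case: f => f /= /bounded_functionalP[]. Qed.

(** This is all that the algebraic part takes from the Hahn-Banach theorem; as a property of [X] it
    lets that part treat real and complex scalars at once. *)
Definition separating_dual := forall x : X, x != 0 -> exists f : dual, f x != 0.

End Dual.

(** * Separation of points over the real and the complex field *)

Section HahnBanachDual.
Variable R : realType.

Lemma separating_dual_real (X : normedModType R) : separating_dual X.
Proof.
move=> x x0.
have [|f [fD fZ f_le fx]] :=
    @hahn_banach_sublinear R R idfun X (fun y => `|y|) x.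
  split=> [y z|t y t0]; first exact: ler_normD.
  by rewrite normrZ ger0_norm.
have fl : linear (f : X -> R^o) by move=> a y z; rewrite fD fZ.
have f_bnd y : `|f y| <= 1 * `|y|.
  rewrite mul1r ler_norml f_le andbT lerNl; have := f_le (- y).
  by rewrite normrN -[- y]scaleN1r fZ mulN1r.
have fP : (f : X -> R^o) \in @bounded_functional R X.
  by apply/bounded_functionalP; split=> //; exists 1.
by exists (Dual fP); rewrite /= fx normr_eq0.
Qed.

(** A real-linear [f] dominated by the norm is the real part of the complex-linear
    [g y = f y - i f (i y)], which is nonzero wherever [f] is. *)
Lemma separating_dual_complex (X : normedModType R[i]) : separating_dual X.
Proof.
move=> x x0; pose p (y : X) := complex.Re `|y|.
have pE y : `|y| = (p y)%:C%C.
  have : 0 <= `|y| by [].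
  by rewrite /p; case: `|y| => a b; rewrite lecE /= => /andP[/eqP ->].
have [|f [fD fZ f_le fx]] :=
    @hahn_banach_sublinear R R[i] (real_complex R) X p x.
  split=> [y z|t y t0].
    by rewrite -lecR rmorphD /= -!pE ler_normD.
  have := normrZ t%:C%C y; rewrite /p => ->.
  rewrite pE normc_def /= expr0n addr0 sqrtr_sqr ger0_norm//.
  by rewrite mul0r subr0.
have f_bnd y : `|f y| <= p y.
  rewrite ler_norml f_le andbT lerNl; have := f_le (- y).
  by rewrite /p normrN -[- y]scaleN1r -[-1](rmorphN1 (real_complex R)) fZ mulN1r.
pose J : R[i] := 'i%C.
have JJ y : J *: (J *: y) = - y by rewrite scalerA -expr2 sqr_i scaleN1r.
have p_J y : p (J *: y) = p y.
  by rewrite /p normrZ normc_def /= expr0n expr1n add0r sqrtr1 mul1r.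
have fC c d y : f ((c +i* d)%C *: y) = c * f y + d * f (J *: y).
  by rewrite (complexE (c +i* d)%C) scalerDl fD fZ /= [_ * d%:C%C]mulrC -scalerA fZ.
pose g y : R[i] := (f y -i* f (J *: y))%C.
have gl : linear (g : X -> R[i]^o).
  move=> [c d] y z.
  have fN u : f (- u) = - f u.
    by rewrite -scaleN1r -(rmorphN1 (real_complex R)) fZ mulN1r.
  have e1 : f ((c +i* d)%C *: y + z) = c * f y + d * f (J *: y) + f z.
    by rewrite fD fC.
  have e2 : f (J *: ((c +i* d)%C *: y + z)) = c * f (J *: y) - d * f y + f (J *: z).
    have -> : J *: ((c +i* d)%C *: y + z) = (c +i* d)%C *: (J *: y) + J *: z.
      by rewrite scalerDr !scalerA [J * _]mulrC.
    by rewrite fD fC JJ fN mulrN.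
  rewrite /g e1 e2.
  apply/eqP; rewrite eq_complex; apply/andP; split; apply/eqP => /=; ring.
(* A crude constant: both parts of [g y] are at most [p y] in absolute value, and
   [p y ^+ 2 + p y ^+ 2 <= (2 * p y) ^+ 2]. *)
have g_bnd y : `|g y| <= 2 * `|y|.
  rewrite pE normc_def /= -(rmorphMn (real_complex R) 2 1) -rmorphM lecR.
  have /andP[f1 f2] : - p y <= f y <= p y by rewrite -ler_norml.
  have /andP[f3 f4] : - p y <= f (J *: y) <= p y by rewrite -ler_norml -p_J.
  have p0 : 0 <= p y by lra.
  rewrite -[leRHS]ger0_norm ?mulr_ge0// -sqrtr_sqr; apply: ler_wsqrtr.
  have sq_le (u : R) : - p y <= u -> u <= p y -> u ^+ 2 <= p y ^+ 2.
    move=> u1 u2; rewrite -subr_ge0 subr_sqr mulr_ge0 ?subr_ge0//.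
    by rewrite -lerBlDl sub0r.
  have := sq_le _ f1 f2; have := sq_le _ f3 f4.
  rewrite exprMn sqrrN; have := sqr_ge0 (p y).
  lra.
have gP : (g : X -> R[i]^o) \in @bounded_functional R[i] X.
  by apply/bounded_functionalP; split=> //; exists 2.
exists (Dual gP); apply/negP => /eqP /(congr1 (@complex.Re R)) /= fx0.
by move/negP: x0; apply; rewrite -normr_eq0 pE -fx fx0.
Qed.
End HahnBanachDual.

(** * Locally proportional linear maps *)

Section LinearAlgebra.
Variable K : fieldType.
Implicit Types V W : lmodType K.

Definition indep2 W (u v : W) := forall a b, a *: u + b *: v = 0 -> a = 0 /\ b = 0.

(** Dimension at least three, finite or infinite. *)
Definition has_dim3 W := forall u v : W, exists w, forall a b, w <> a *: u + b *: v.

Lemma indep2P W (u v : W) : u != 0 -> (forall a, v <> a *: u) -> indep2 u v.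
Proof.
move=> u0 vu a b; have [->|b0] := eqVneq b 0.
  by rewrite scale0r addr0 => /eqP; rewrite scaler_eq0 (negPf u0) orbF => /eqP.
move=> /eqP; rewrite addr_eq0 => /eqP abuv; case: (vu (- (b^-1 * a))).
by rewrite scaleNr -scalerA abuv scalerN opprK scalerA mulVf ?scale1r.
Qed.

Lemma indep2_eq W (u v : W) a b c d : indep2 u v ->
  a *: u + b *: v = c *: u + d *: v -> a = c /\ b = d.
Proof.
move=> uv /eqP; rewrite -subr_eq0 opprD addrACA -!scalerBl => /eqP /uv [].
by move=> /eqP; rewrite subr_eq0 => /eqP -> /eqP; rewrite subr_eq0 => /eqP ->.
Qed.

Lemma indep2_neq0l W (u v : W) : indep2 u v -> u != 0.
Proof.
move=> uv; apply/eqP => u0; have [|/eqP] := uv 1 0.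
  by rewrite u0 scaler0 scale0r addr0.
by rewrite oner_eq0.
Qed.

Lemma indep2C W (u v : W) : indep2 u v -> indep2 v u.
Proof. by move=> uv a b; rewrite addrC => /uv []. Qed.

Section Linear.
Variables (V W : lmodType K) (S : V -> W) (Sl : linear S).
Lemma linear_add u v : S (u + v) = S u + S v.
Proof. by have := Sl 1 u v; rewrite !scale1r. Qed.
Lemma linear_zero : S 0 = 0.
Proof. by apply: (addrI (S 0)); rewrite -linear_add !addr0. Qed.
Lemma linear_scale a u : S (a *: u) = a *: S u.
Proof. by have := Sl a u 0; rewrite linear_zero !addr0. Qed.
End Linear.

(** Where [T u] and [T v] are independent, the value at [u + v] shows that the factors at [u] and
    [v] agree. Every [v] can be compared in this way with [v1] or [v2], unless [T v] is a multiple
    of both [T v1] and [T v2] and so vanishes. *)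
Lemma locally_proportional V W (S T : V -> W) v1 v2 :
  linear S -> linear T -> indep2 (T v1) (T v2) ->
  (forall v, exists c, S v = c *: T v) -> exists c, forall v, S v = c *: T v.
Proof.
move=> Sl Tl T12 ST.
have key u v a b : indep2 (T u) (T v) -> S u = a *: T u -> S v = b *: T v -> a = b.
  move=> uv Su Sv; have [c] := ST (u + v).
  rewrite (linear_add Sl) (linear_add Tl) Su Sv scalerDr.
  by move=> /(indep2_eq uv)[-> ->].
have [c1 S1] := ST v1; have [c2 S2] := ST v2.
have c12 := key _ _ _ _ T12 S1 S2; rewrite -{}c12 in S2.
exists c1 => v; have [c Sv] := ST v.
have [[a Ta]|nTa] := pselect (exists a, T v = a *: T v1); last first.
  rewrite Sv (key v1 v c1 c)//; apply: indep2P; first exact: indep2_neq0l T12.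
  by move=> a Ta; apply: nTa; exists a.
have [[b Tb]|nTb] := pselect (exists b, T v = b *: T v2); last first.
  rewrite Sv (key v2 v c1 c)//; apply: indep2P.
    exact: indep2_neq0l (indep2C T12).
  by move=> b Tb; apply: nTb; exists b.
have : a *: T v1 + (- b) *: T v2 = 0 by rewrite -Ta scaleNr -Tb subrr.
by move=> /T12[a0 _]; rewrite Sv Ta a0 scale0r !scaler0.
Qed.

(* [good u] is meant to say that [T u] has the smallest possible kernel, the line
   spanned by [u]. *)
Lemma alternating_proportional V W (S T : V -> V -> W) (good : V -> Prop) v0 :
  (forall u, linear (S u)) -> (forall v, linear (S ^~ v)) -> (forall u, S u u = 0) ->
  (forall u, linear (T u)) -> (forall v, linear (T ^~ v)) -> (forall u, T u u = 0) ->
  has_dim3 V -> good v0 -> (forall u, good u \/ good (u + v0)) ->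
  (forall u v, good u -> T u v = 0 -> exists a, v = a *: u) ->
  (forall u v, good u -> exists c, S u v = c *: T u v) ->
  exists c, forall u v, S u v = c *: T u v.
Proof.
move=> Sr Sl S0 Tr Tl T0 V3 good0 goodD kerT ST.
have alt (F : V -> V -> W) : (forall u, linear (F u)) -> (forall v, linear (F ^~ v)) ->
    (forall u, F u u = 0) -> forall u v, F u v = - F v u.
  move=> Fr Fl F0 u v; apply/eqP; rewrite -addr_eq0; apply/eqP.
  have := F0 (u + v); rewrite (linear_add (Fr _)) !(linear_add (Fl _)) !F0.
  by rewrite add0r addr0 addrC.
(* In dimension at least three there are [v1], [v2] independent modulo the line of [u], so [T u v1]
   and [T u v2] are independent. *)
have goodP u : good u -> exists c, forall v, S u v = c *: T u v.
  move=> gu; have [v1 v1P] := V3 u u; have [v2 v2P] := V3 u v1.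
  apply: (@locally_proportional V W (S u) (T u) v1 v2) => //; last first.
    by move=> v; exact: ST.
  move=> a b; rewrite -!(linear_scale (Tr u)) -(linear_add (Tr u)).
  move=> /(kerT _ _ gu)[e abe].
  have b0 : b = 0.
    apply: contrapT => /eqP b0; apply: (v2P (b^-1 * e) (- (b^-1 * a))).
    rewrite scaleNr -!scalerA -abe -scalerBr addrC addrA addNr add0r.
    by rewrite scalerA mulVf ?scale1r.
  split=> //; apply: contrapT => /eqP a0; apply: (v1P (a^-1 * e) 0).
  by rewrite -scalerA -abe b0 !scale0r !addr0 scalerA mulVf ?scale1r.
have [c Sc] := goodP _ good0; exists c => u v.
(* The factors of [w] and [v0] are compared at the pair [w], [v0], using that both maps alternate;
   if [T v0 w] vanishes, [w] is a multiple of [v0]. *)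
have goodE w z : good w -> S w z = c *: T w z.
  move=> gw; have [b Sb] := goodP _ gw.
  have [T0w|Tw0] := eqVneq (T v0 w) 0.
    have [a ->] := kerT _ _ good0 T0w.
    rewrite (linear_scale (Sl z)) (linear_scale (Tl z)) Sc.
    by rewrite !scalerA mulrC.
  rewrite Sb; congr (_ *: _); have := Sb v0.
  rewrite (alt S)// Sc (alt T Tr Tl T0 w) scalerN => /oppr_inj /eqP.
  by rewrite -subr_eq0 -scalerBl scaler_eq0 (negPf Tw0) orbF subr_eq0 => /eqP.
have [/goodE ->//|gu0] := goodD u.
have -> : u = (u + v0) + (-1) *: v0 by rewrite scaleN1r addrK.
rewrite (linear_add (Sl v)) (linear_add (Tl v)).
rewrite (linear_scale (Sl v)) (linear_scale (Tl v)) !goodE//.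
by rewrite scalerDr; congr (_ + _); rewrite !scalerA mulrC.
Qed.

End LinearAlgebra.

(** * Quadratic maps that are pointwise multiples of a linear map *)

Section QuadraticMaps.
Variables (K : numFieldType) (V W : lmodType K).

(** Adding the expansions of [q] at [u + v] and [u - v] cancels the mixed terms; the coefficients of
    [T u] and [T v] then give [d (u + v) + d (u - v) = 2 * d u] and
    [d (u + v) - d (u - v) = 2 * d v]. The value [d 0], which the equation leaves free, is fixed by
    assumption. *)
Lemma quadratic_multiple (q : V -> V -> W) (T : V -> W) (d : V -> K) :
  (forall u, linear (q u)) -> (forall v, linear (q ^~ v)) ->
  linear T -> injective T -> d 0 = 0 -> (forall v, q v v = d v *: T v) ->
  (forall a u v, d (a *: u + v) = a * d u + d v) /\
  (forall u v, q u v + q v u = d u *: T v + d v *: T u).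
Proof.
move=> qr ql Tl Ti d0 qT.
have T0 v : T v = 0 -> v = 0 by move=> Tv; apply: Ti; rewrite Tv linear_zero.
have qD u v : q (u + v) (u + v) = q u u + (q u v + q v u) + q v v.
  by rewrite (linear_add (qr _)) !(linear_add (ql _)) !addrA (addrAC (q u u)).
have dZ a v : d (a *: v) = a * d v.
  have [->|a0] := eqVneq a 0; first by rewrite scale0r d0 mul0r.
  have [->|v0] := eqVneq v 0; first by rewrite scaler0 d0 mulr0.
  have Tv0 : T v != 0 by apply: contra v0 => /eqP/T0 ->.
  have := qT (a *: v).
  rewrite (linear_scale (qr _)) (linear_scale (ql _)) qT (linear_scale Tl) !scalerA.
  move=> /eqP; rewrite -subr_eq0 -scalerBl scaler_eq0 (negPf Tv0) orbF subr_eq0.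
  by move=> /eqP/esym daa; apply: (mulIf a0); rewrite daa; ring.
have dD u v : d (u + v) = d u + d v.
  have [->|u0] := eqVneq u 0; first by rewrite add0r d0 add0r.
  have Tu0 : T u != 0 by apply: contra u0 => /eqP/T0 ->.
  have [[a ->]|nuv] := pselect (exists a, v = a *: u).
    by rewrite -{1}[u]scale1r -scalerDl !dZ mulrDl mul1r.
  have Tuv : indep2 (T u) (T v).
    apply: indep2P => // a; rewrite -(linear_scale Tl) => /Ti vu.
    by apply: nuv; exists a.
  have e1 := qD u v; have := qD u (- v).
  have qN w : q w (- v) = - q w v by rewrite -scaleN1r (linear_scale (qr _)) scaleN1r.
  have Nq w : q (- v) w = - q v w by rewrite -scaleN1r (linear_scale (ql _)) scaleN1r.
  have TN : T (- v) = - T v by rewrite -scaleN1r (linear_scale Tl) scaleN1r.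
  move: e1; rewrite !qN !Nq opprK -opprD !qT !(linear_add Tl) TN.
  set B := q u v + _ => e1 e2.
  have [e3 e4] : d (u + v) + d (u - v) = d u + d u /\ d (u + v) - d (u - v) = d v + d v.
    apply: (indep2_eq Tuv).
    transitivity (d (u + v) *: (T u + T v) + d (u - v) *: (T u - T v)).
      by rewrite scalerDl scalerBl scalerDr scalerBr addrACA.
    rewrite e1 e2 addrACA (addrACA _ B) subrr addr0.
    by rewrite !scalerDl.
  apply: (@mulIf _ 2); first by rewrite pnatr_eq0.
  transitivity ((d (u + v) + d (u - v)) + (d (u + v) - d (u - v))); first by ring.
  by rewrite e3 e4; ring.
split=> [a u v|u v]; first by rewrite dD dZ.
have := qD u v; rewrite !qT dD (linear_add Tl) => e.
apply: (@addrI _ (d u *: T u)); apply: (@addIr _ (d v *: T v)); rewrite -e.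
by rewrite scalerDl !scalerDr !addrA.
Qed.
End QuadraticMaps.

(** * Rank one operators *)

Section RankOne.
Variables (K : numFieldType) (X : normedModType K).
Local Notation A := (boundedOp X).
Local Notation D := (dual X).

Fact rank1_subproof (u : X) (f : D) :
  (fun w => (f w : K) *: u) \in @bounded_operator K X.
Proof.
have /bounded_functionalP[fl [M M0 fM]] := dual_funP f.
apply/bounded_operatorP; split=> [a x y|]; first by rewrite fl scalerDl scalerA.
by exists (M * `|u|) => x; rewrite normrZ mulrAC; exact: ler_wpM2r.
Qed.

Definition rank1 u f : A := BoundedOp (rank1_subproof u f).

Lemma rank1E u f w : rank1 u f w = (f w : K) *: u. Proof. by []. Qed.
Lemma bop_oppE (T : A) x : (- T) x = - T x. Proof. by []. Qed.
Lemma bopD (T : A) x y : T (x + y) = T x + T y.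
Proof. exact: (linear_add (bop_linear T)). Qed.
Lemma bopZ (T : A) a x : T (a *: x) = a *: T x.
Proof. exact: (linear_scale (bop_linear T)). Qed.
Lemma bopN (T : A) x : T (- x) = - T x.
Proof. by rewrite -scaleN1r bopZ scaleN1r. Qed.
Lemma bop0 (T : A) : T 0 = 0.
Proof. exact: (linear_zero (bop_linear T)). Qed.
Lemma dualD (f : D) x y : f (x + y) = f x + f y :> K.
Proof. exact: (linear_add (dual_linear f)). Qed.
Lemma dualZ (f : D) a x : f (a *: x) = a * f x :> K.
Proof. exact: (linear_scale (dual_linear f)). Qed.
Lemma dualN (f : D) x : f (- x) = - f x :> K.
Proof. by rewrite -scaleN1r dualZ mulN1r. Qed.
Lemma dual0 (f : D) : f 0 = 0 :> K.
Proof. exact: (linear_zero (dual_linear f)). Qed.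
Lemma dual_addE (f g : D) x : (f + g) x = f x + g x :> K. Proof. by []. Qed.
Lemma dual_scaleE a (f : D) x : (a *: f) x = a * f x :> K. Proof. by []. Qed.
Lemma dual_oppE (f : D) x : (- f) x = - f x :> K. Proof. by []. Qed.
Lemma dual_zeroE x : (0 : D) x = 0 :> K. Proof. by []. Qed.
Lemma bop_zeroE x : (0 : A) x = 0. Proof. by []. Qed.

(* Operator identities are proved by applying a functional to their values at a
   vector, which leaves a [ring] goal in [K].  [opE] must be exhausted before
   [linE], whose rules would see through pointwise sums of operators. *)
Definition opE := (bop_addE, bop_oppE, bop_scaleE, bop_oneE, bop_mulE, bop_zeroE,
  rank1E, dual_addE, dual_oppE, dual_scaleE, dual_zeroE).

Definition linE := (bopD, bopN, bopZ, bop0, dualD, dualN, dualZ, dual0).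

Hypothesis sepX : separating_dual X.

Lemma dual_eq x y : (forall h : D, h x = h y :> K) -> x = y.
Proof.
move=> hxy; apply/eqP; rewrite -subr_eq0; apply: contrapT => /negP/sepX[h].
by rewrite dualD dualN hxy subrr eqxx.
Qed.

Lemma bop_eq (S T : A) : (forall (h : D) w, h (S w) = h (T w) :> K) -> S = T.
Proof. by move=> hST; apply: bop_ext => w; apply: dual_eq => h; exact: hST. Qed.

Lemma dual_normalized x : x != 0 -> exists h : D, h x = 1 :> K.
Proof.
by move=> /sepX[h hx]; exists ((h x : K)^-1 *: h); rewrite dual_scaleE mulVf.
Qed.

Lemma dual_neq0P (f : D) : f != 0 -> exists x, f x = 1 :> K.
Proof.
move=> f0; have [[x fx]|nf] := pselect (exists x, f x != 0 :> K).
  by exists ((f x : K)^-1 *: x); rewrite dualZ mulVf.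
case/eqP: f0; apply: dual_ext => x; apply: contrapT => /eqP fx.
by apply: nf; exists x.
Qed.

Lemma rank1Dl u v f : rank1 (u + v) f = rank1 u f + rank1 v f.
Proof. by apply: bop_eq => h w; rewrite ?opE ?linE; ring. Qed.
Lemma rank1Zl a u f : rank1 (a *: u) f = a *: rank1 u f.
Proof. by apply: bop_eq => h w; rewrite ?opE ?linE; ring. Qed.
Lemma rank1Dr u f g : rank1 u (f + g) = rank1 u f + rank1 u g.
Proof. by apply: bop_eq => h w; rewrite ?opE ?linE; ring. Qed.
Lemma rank1Zr a u f : rank1 u (a *: f) = a *: rank1 u f.
Proof. by apply: bop_eq => h w; rewrite ?opE ?linE; ring. Qed.
Lemma rank10l f : rank1 0 f = 0.
Proof. by rewrite -(scale0r (0 : X)) rank1Zl scale0r. Qed.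
Lemma rank10r u : rank1 u 0 = 0.
Proof. by rewrite -(scale0r (0 : D)) rank1Zr scale0r. Qed.

Definition is_scalar (a : A) := exists c, a = c *: (1 : A).

(** Commutation with [rank1 x f], evaluated at [e] with [f e = 1], reads [a x = f (a e) *: x]. *)
Lemma commute_rank1_scalar a :
  (forall u f, a * rank1 u f = rank1 u f * a) -> is_scalar a.
Proof.
move=> ca; have [[e e0]|X0] := pselect (exists e : X, e != 0); last first.
  exists 0; apply: bop_ext => x; have -> : x = 0; last by rewrite !bop0.
  by apply: contrapT => /eqP x0; apply: X0; exists x.
have [f fe] := dual_normalized e0; exists (f (a e)); apply: bop_ext => x.
by have := congr1 (fun T : A => T e) (ca x f); rewrite ?opE ?linE fe scale1r.
Qed.

Section Projection.
Variables (e : X) (f : D).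
Hypothesis fe : f e = 1 :> K.

(* A linear projection whose kernel is the space of scalar operators, used in
   place of the quotient by it. *)
Definition mod_scalar (a : A) : A := a - (f (a e) : K) *: (1 : A).

Lemma mod_scalar_linear : linear mod_scalar.
Proof. by move=> a S T; apply: bop_eq => h w; rewrite /mod_scalar ?opE ?linE; ring. Qed.

Lemma mod_scalar_eq0 a : mod_scalar a = 0 <-> is_scalar a.
Proof.
split=> [/eqP|[c ->]]; first by rewrite subr_eq0 => /eqP; exists (f (a e)).
by rewrite /mod_scalar ?opE ?linE fe mulr1 subrr.
Qed.

Lemma mod_scalarP a b : mod_scalar a = mod_scalar b <-> is_scalar (a - b).
Proof.
rewrite -mod_scalar_eq0 (linear_add mod_scalar_linear) -[- b]scaleN1r.
rewrite (linear_scale mod_scalar_linear) scaleN1r.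
by split=> [->|/eqP]; [rewrite subrr | rewrite subr_eq0 => /eqP].
Qed.

End Projection.

(** Dimension at least two, finite or infinite. *)
Definition has_dim2 (W : lmodType K) := forall u : W, exists w, forall a, w <> a *: u.

Lemma has_dim3_dim2 (W : lmodType K) : has_dim3 W -> has_dim2 W.
Proof.
move=> W3 u; have [w wP] := W3 u u; exists w => a wa; apply: (wP a 0).
by rewrite scale0r addr0.
Qed.

Lemma has_dim2_neq0 (W : lmodType K) : has_dim2 W -> exists u : W, u != 0.
Proof.
by move=> /(_ 0)[w wP]; exists w; apply/eqP => w0; apply: (wP 0); rewrite w0 scale0r.
Qed.

Lemma has_dim2_indep2 (W : lmodType K) (u : W) : has_dim2 W -> u != 0 ->
  exists v, indep2 u v.
Proof. by move=> /(_ u)[w wP] u0; exists w; exact: indep2P. Qed.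

Lemma dual_kernel_neq0 (f : D) : has_dim2 X -> exists2 w, w != 0 & f w = 0 :> K.
Proof.
move=> X2; have [->|/dual_neq0P[x fx]] := eqVneq f 0.
  by have [u u0] := has_dim2_neq0 X2; exists u.
have [v vP] := X2 x; exists (v - (f v : K) *: x); last first.
  by rewrite ?opE ?linE fx mulr1 subrr.
by rewrite subr_eq0; apply/eqP; exact: vP.
Qed.

(** If [f'] vanished on the kernel of [f], it would equal [f' x *: f] for any [x] with [f x = 1]. So
    [w2] is found in that kernel, and [w1] is [x] corrected by a multiple of [w2]. *)
Lemma dual_basis (f f' : D) : indep2 f f' -> exists w1 w2,
  [/\ f w1 = 1 :> K, f' w1 = 0 :> K, f w2 = 0 :> K & f' w2 = 1 :> K].
Proof.
move=> ff'; have [x fx] := dual_neq0P (indep2_neq0l ff').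
have [[w fw f'w]|nw] := pselect (exists2 w, f w = 0 :> K & f' w != 0 :> K).
  have [w2 fw2 f'w2] : exists2 w2, f w2 = 0 :> K & f' w2 = 1 :> K.
    by exists ((f' w : K)^-1 *: w); rewrite dualZ ?fw ?mulr0 ?mulVf.
  exists (x - (f' x : K) *: w2), w2; split=> //.
    by rewrite ?opE ?linE fw2 fx mulr0 subr0.
  by rewrite ?opE ?linE f'w2 mulr1 subrr.
have [] := ff' (f' x) (- 1); last by move=> _ /eqP; rewrite oppr_eq0 oner_eq0.
apply: dual_ext => w; rewrite ?opE ?linE.
have : f' (w - (f w : K) *: x) = 0 :> K.
  apply: contrapT => /eqP f'w; apply: nw; exists (w - (f w : K) *: x) => //.
  by rewrite ?opE ?linE fx mulr1 subrr.
rewrite ?opE ?linE => /eqP; rewrite subr_eq0 => /eqP ->.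
by ring.
Qed.

Lemma dual_kernel2_neq0 (f f' : D) : has_dim3 X ->
  exists w, [/\ w != 0, f w = 0 :> K & f' w = 0 :> K].
Proof.
move=> X3; have X2 := has_dim3_dim2 X3.
have [->|f0] := eqVneq f 0.
  by have [w w0 fw] := dual_kernel_neq0 f' X2; exists w.
have [[a ->]|nff'] := pselect (exists a, f' = a *: f).
  by have [w w0 fw] := dual_kernel_neq0 f X2; exists w; rewrite ?opE ?linE fw mulr0.
have [|w1 [w2 [e11 e21 e12 e22]]] := @dual_basis f f'.
  by apply: indep2P => // a fa; apply: nff'; exists a.
have [w wP] := X3 w1 w2; exists (w - (f w : K) *: w1 - (f' w : K) *: w2).
split; last 2 first.
- by rewrite ?opE ?linE e11 e12; ring.
- by rewrite ?opE ?linE e21 e22; ring.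
by rewrite -addrA -opprD subr_eq0; apply/eqP; exact: wP.
Qed.

Lemma has_dim2_dual : has_dim2 X -> has_dim2 D.
Proof.
move=> X2 f; have [w w0 fw] := dual_kernel_neq0 f X2.
have [g gw] := sepX w0; exists g => a ga.
by move: gw; rewrite ga ?opE ?linE fw mulr0 eqxx.
Qed.

Lemma has_dim3_dual : has_dim3 X -> has_dim3 D.
Proof.
move=> X3 f f'; have [w [w0 fw f'w]] := dual_kernel2_neq0 f f' X3.
have [g gw] := sepX w0; exists g => a b gab.
by move: gw; rewrite gab ?opE ?linE fw f'w !mulr0 addr0 eqxx.
Qed.

Lemma rank1_scalar_eq0 u f : has_dim2 X -> is_scalar (rank1 u f) -> u = 0 \/ f = 0.
Proof.
move=> X2 [c rc]; have [w w0 fw] := dual_kernel_neq0 f X2.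
have c0 : c = 0.
  have := congr1 (fun T : A => T w) rc; rewrite ?opE ?linE fw scale0r => /eqP.
  by rewrite eq_sym scaler_eq0 (negPf w0) orbF => /eqP.
have [->|/dual_neq0P[x fx]] := eqVneq f 0; first by right.
left; have := congr1 (fun T : A => T x) rc.
by rewrite ?opE ?linE fx c0 scale0r scale1r.
Qed.

(** The last hypothesis says that the commutator of [a] with each [rank1 v h] maps the common kernel
    of [f] and [f'] into the span of [u] and [u']. Taking [w0] with [h0 w0 = 1] makes [a] the scalar
    [c] modulo that span. *)
Lemma scalar_kernel_image (a : A) u u' (f f' : D) w0 v0 :
  w0 != 0 -> f w0 = 0 :> K -> f' w0 = 0 :> K ->
  (forall b c, v0 <> b *: u + c *: u') ->
  (forall v (h : D) w, f w = 0 :> K -> f' w = 0 :> K ->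
    exists b c, (h w : K) *: a v - (h (a w) : K) *: v = b *: u + c *: u') ->
  exists c, (forall w, f w = 0 :> K -> f' w = 0 :> K -> a w = c *: w) /\
            (forall v, exists b b', a v = c *: v + (b *: u + b' *: u')).
Proof.
move=> w00 fw0 f'w0 v0P aP; have [h0 h0w0] := dual_normalized w00.
pose c := h0 (a w0) : K; exists c.
have aE v : exists b b', a v = c *: v + (b *: u + b' *: u').
  have [b [b' E]] := aP v h0 w0 fw0 f'w0; exists b, b'.
  by rewrite -E h0w0 scale1r addrC subrK.
split=> // w fw f'w; apply: dual_eq => h; rewrite ?opE ?linE.
have [b [b' E]] := aP v0 h w fw f'w; have [d [d' E']] := aE v0.
(* The multiple [k *: v0] lies in the span of [u] and [u'] while [v0] does not, so [k] must
   vanish. *)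
apply: contrapT => /eqP; rewrite -subr_eq0 => hw0; set k := _ - _ in hw0.
apply: (v0P (- (k^-1 * (b - (h w : K) * d))) (- (k^-1 * (b' - (h w : K) * d')))).
have kv0 : k *: v0 = - (b *: u + b' *: u') + (h w : K) *: (d *: u + d' *: u').
  by rewrite -E E'; apply: dual_eq => g; rewrite /k ?opE ?linE; ring.
rewrite -[LHS](scale1r) -(mulVf hw0) -scalerA kv0.
by apply: dual_eq => g; rewrite ?opE ?linE; ring.
Qed.

(** On the kernel of [f] the commutator of [b] with [rank1 u f] has its values in the line of [u].
    Hence [a] is a scalar on that kernel and modulo [u], and its value at one [x] with [f x = 1]
    determines [d]. *)
Lemma scalar_plus_rank1 (a : A) u f : has_dim2 X -> u != 0 -> f != 0 ->
  (forall v h, exists b, a * rank1 v h - rank1 v h * a = b * rank1 u f - rank1 u f * b) ->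
  exists d, is_scalar (a - d *: rank1 u f).
Proof.
move=> X2 u0 f0 aP; have [w0 w00 fw0] := dual_kernel_neq0 f X2.
have [v0 v0P] := X2 u; have [x fx] := dual_neq0P f0.
have [||c [ac aE]] := @scalar_kernel_image a u u f f w0 v0 w00 fw0 fw0.
- by move=> b c; rewrite -scalerDl; exact: v0P.
- move=> v h w fw _; have [b E] := aP v h; exists (- f (b w) : K), 0.
  have := congr1 (fun T : A => T w) E; rewrite ?opE ?linE fw => ->.
  by rewrite !scale0r sub0r addr0 scaleNr.
have [b [b' ax]] := aE x; exists (b + b'), c; apply: bop_ext => y.
have := ac (y - (f y : K) *: x); rewrite ?opE ?linE fx mulr1 subrr => /(_ erefl erefl).
rewrite ax => /eqP; rewrite subr_eq => /eqP ->.
by apply: dual_eq => g; rewrite ?opE ?linE; ring.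
Qed.

End RankOne.

(** * Commuting traces *)

Section CommutingTrace.
Variables (K : numFieldType) (X : normedModType K).
Local Notation A := (boundedOp X).
Local Notation D := (dual X).
Local Notation rank1 := (@rank1 K X).
Hypothesis sepX : separating_dual X.

Variable q : A -> A -> A.
Hypothesis qr : forall x, linear (q x).
Hypothesis ql : forall y, linear (q ^~ y).
Hypothesis q_comm : forall x, q x x * x = x * q x x.

Let qDr x y z : q x (y + z) = q x y + q x z. Proof. exact: linear_add. Qed.
Let qDl x y z : q (x + y) z = q x z + q y z. Proof. exact: (linear_add (ql z)). Qed.
Let qZr a x y : q x (a *: y) = a *: q x y. Proof. exact: linear_scale. Qed.
Let qZl a x y : q (a *: x) y = a *: q x y. Proof. exact: (linear_scale (ql y)). Qed.
Let qNr x y : q x (- y) = - q x y. Proof. by rewrite -scaleN1r qZr scaleN1r. Qed.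
Let qNl x y : q (- x) y = - q x y. Proof. by rewrite -scaleN1r qZl scaleN1r. Qed.
Let qE := (qDr, qDl, qZr, qZl, qNr, qNl).

Definition polar x y := q x y + q y x.

(** This is the part of the cubic commutation identity of degree two in [x]: subtracting the
    identities at [x + y] and [x - y] leaves twice this part plus twice the identity at [y]. *)
Lemma polar_comm2 x y :
  polar x y * x - x * polar x y + (q x x * y - y * q x x) = 0.
Proof.
have e1 := q_comm (x + y); have e2 := q_comm (x - y).
apply: (@scalerI _ _ (2 : K)); first by rewrite pnatr_eq0.
transitivity (q (x + y) (x + y) * (x + y) - (x + y) * q (x + y) (x + y) -
    (q (x - y) (x - y) * (x - y) - (x - y) * q (x - y) (x - y)) -
    (2 : K) *: (q y y * y - y * q y y)).
  by apply: bop_eq => // h w; rewrite /polar !qE ?opE ?linE; ring.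
by rewrite e1 e2 q_comm !subrr !scaler0 subr0.
Qed.

Lemma polar_comm3 x y z :
  polar x y * z - z * polar x y + (polar y z * x - x * polar y z) +
    (polar z x * y - y * polar z x) = 0.
Proof.
transitivity ((polar (x + z) y * (x + z) - (x + z) * polar (x + z) y +
    (q (x + z) (x + z) * y - y * q (x + z) (x + z))) -
  (polar x y * x - x * polar x y + (q x x * y - y * q x x)) -
  (polar z y * z - z * polar z y + (q z z * y - y * q z z))).
  by apply: bop_eq => // h w; rewrite /polar !qE ?opE ?linE; ring.
by rewrite !polar_comm2 !subrr.
Qed.

Hypothesis X2 : has_dim2 X.

Lemma trace_rank1 u f : exists d, is_scalar (q (rank1 u f) (rank1 u f) - d *: rank1 u f).
Proof.
have [->|u0] := eqVneq u 0.
  exists 0, 0; rewrite rank10l// -{1}(scale0r (0 : A)) qZl !scale0r.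
  by rewrite subrr.
have [->|f0] := eqVneq f 0.
  exists 0, 0; rewrite rank10r// -{1}(scale0r (0 : A)) qZl !scale0r.
  by rewrite subrr.
apply: scalar_plus_rank1 => // v h; exists (- polar (rank1 u f) (rank1 v h)).
have := polar_comm2 (rank1 u f) (rank1 v h).
rewrite addrC => /eqP; rewrite addr_eq0 => /eqP ->.
by rewrite mulNr mulrN opprB opprK addrC.
Qed.

(** [quadratic_multiple] is applied modulo scalars, once in the vector for fixed [f] and once in the
    functional for fixed [u]; injectivity holds because a nonzero rank one operator is not
    scalar. *)
Lemma trace_rank1_coef : exists d : X -> D -> K,
  [/\ forall u, linear (d u : D -> K^o), forall f, linear (d ^~ f : X -> K^o),
    forall u f, is_scalar (q (rank1 u f) (rank1 u f) - d u f *: rank1 u f),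
    forall u v f, is_scalar (polar (rank1 u f) (rank1 v f)
      - d u f *: rank1 v f - d v f *: rank1 u f) &
    forall u f g, is_scalar (polar (rank1 u f) (rank1 u g)
      - d u f *: rank1 u g - d u g *: rank1 u f)].
Proof.
have [e e0] := has_dim2_neq0 X2; have [e' e'e] := dual_normalized sepX e0.
pose pi := mod_scalar e e'.
have pil : linear pi by exact: mod_scalar_linear.
have piP a b : pi a = pi b <-> is_scalar (a - b) by exact: mod_scalarP.
pose d0 u f : K := sval (cid (trace_rank1 u f)).
have d0P u f : is_scalar (q (rank1 u f) (rank1 u f) - d0 u f *: rank1 u f).
  exact: svalP (cid (trace_rank1 u f)).
(* For a zero operator the chosen factor is arbitrary; linearity forces it to be 0. *)
pose d (u : X) (f : D) : K := if (u == 0) || (f == 0) then 0 else d0 u f.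
have d0f f : d 0 f = 0 by rewrite /d eqxx.
have du0 u : d u 0 = 0 by rewrite /d eqxx orbT.
have dP u f : is_scalar (q (rank1 u f) (rank1 u f) - d u f *: rank1 u f).
  rewrite /d; case: ifPn => // /orP[] /eqP ->; exists 0.
    by rewrite rank10l// -{1}(scale0r (0 : A)) qZl !scale0r subrr.
  by rewrite rank10r// -{1}(scale0r (0 : A)) qZl !scale0r subrr.
have pi0 u f : pi (rank1 u f) = 0 -> u = 0 \/ f = 0.
  by move=> /mod_scalar_eq0 -/(_ e'e); exact: rank1_scalar_eq0.
have left f : (forall a u v, d (a *: u + v) f = a * d u f + d v f) /\
    forall u v, pi (polar (rank1 u f) (rank1 v f)) =
      pi (d u f *: rank1 v f + d v f *: rank1 u f).
  have [->|f0] := eqVneq f 0.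
    split=> [a u v|u v]; first by rewrite !du0 mulr0 addr0.
    rewrite /polar !rank10r// !scaler0 addr0 -{1 3}(scale0r (0 : A)).
    by rewrite !qZl !scale0r addr0.
  have [||||||dl dE] := @quadratic_multiple K X A
      (fun u v => pi (q (rank1 u f) (rank1 v f))) (fun u => pi (rank1 u f)) (d ^~ f).
  - by move=> u a v w; rewrite rank1Dl// rank1Zl// qr pil.
  - by move=> u a v w; rewrite rank1Dl// rank1Zl// ql pil.
  - by move=> a u v; rewrite rank1Dl// rank1Zl// pil.
  - move=> u v puv; have := pi0 (u - v) f.
    have -> : rank1 (u - v) f = rank1 u f - rank1 v f.
      by rewrite -scaleN1r rank1Dl// rank1Zl// scaleN1r.
    rewrite -[- rank1 v f]scaleN1r (linear_add pil) (linear_scale pil) puv.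
    rewrite scaleN1r subrr => /(_ erefl)[/eqP|f00].
      by rewrite subr_eq0 => /eqP.
    by rewrite f00 eqxx in f0.
  - exact: d0f.
  - by move=> u; rewrite -(linear_scale pil); apply/piP.
  split=> // u v; rewrite /polar !(linear_add pil) !(linear_scale pil).
  exact: dE.
have right u : (forall a f g, d u (a *: f + g) = a * d u f + d u g) /\
    forall f g, pi (polar (rank1 u f) (rank1 u g)) =
      pi (d u f *: rank1 u g + d u g *: rank1 u f).
  have [->|u0] := eqVneq u 0.
    split=> [a f g|f g]; first by rewrite !d0f mulr0 addr0.
    rewrite /polar !rank10l// !scaler0 addr0 -{1 3}(scale0r (0 : A)).
    by rewrite !qZl !scale0r addr0.
  have [||||||dl dE] := @quadratic_multiple K D A
      (fun f g => pi (q (rank1 u f) (rank1 u g))) (fun f => pi (rank1 u f)) (d u).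
  - by move=> f a g h; rewrite rank1Dr// rank1Zr// qr pil.
  - by move=> f a g h; rewrite rank1Dr// rank1Zr// ql pil.
  - by move=> a f g; rewrite rank1Dr// rank1Zr// pil.
  - move=> f g pfg; have := pi0 u (f - g).
    have -> : rank1 u (f - g) = rank1 u f - rank1 u g.
      by rewrite -scaleN1r rank1Dr// rank1Zr// scaleN1r.
    rewrite -[- rank1 u g]scaleN1r (linear_add pil) (linear_scale pil) pfg.
    rewrite scaleN1r subrr => /(_ erefl)[u00|/eqP].
      by rewrite u00 eqxx in u0.
    by rewrite subr_eq0 => /eqP.
  - exact: du0.
  - by move=> f; rewrite -(linear_scale pil); apply/piP.
  split=> // f g; rewrite /polar !(linear_add pil) !(linear_scale pil).
  exact: dE.
exists d; split=> //.
- by move=> u; exact: (right u).1.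
- by move=> f; exact: (left f).1.
- by move=> u v f; rewrite -addrA -opprD; apply/piP; exact: (left f).2.
- by move=> u f g; rewrite -addrA -opprD; apply/piP; exact: (right u).2.
Qed.

(** * The remainder on rank one operators *)

Variable d : X -> D -> K.
Hypothesis dr : forall u, linear (d u : D -> K^o).
Hypothesis dl : forall f, linear (d ^~ f : X -> K^o).
Hypothesis dP : forall u f, is_scalar (q (rank1 u f) (rank1 u f) - d u f *: rank1 u f).
Hypothesis dPl : forall u v f, is_scalar (polar (rank1 u f) (rank1 v f)
      - d u f *: rank1 v f - d v f *: rank1 u f).
Hypothesis dPr : forall u f g, is_scalar (polar (rank1 u f) (rank1 u g)
      - d u f *: rank1 u g - d u g *: rank1 u f).

Let dDl u v f : d (u + v) f = d u f + d v f. Proof. exact: (linear_add (dl f)). Qed.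
Let dZl a u f : d (a *: u) f = a * d u f. Proof. exact: (linear_scale (dl f)). Qed.
Let dDr u f g : d u (f + g) = d u f + d u g. Proof. exact: (linear_add (dr u)). Qed.
Let dZr a u f : d u (a *: f) = a * d u f. Proof. exact: (linear_scale (dr u)). Qed.
Let dE := (dDl, dZl, dDr, dZr).

(** The [C r s] of the overview for [r = rank1 u f], [s = rank1 u' f'], written in vectors and
    functionals because it is multilinear in these four arguments. *)
Definition rest u f u' f' := polar (rank1 u f) (rank1 u' f')
  - d u f *: rank1 u' f' - d u' f' *: rank1 u f.

Lemma restC u f u' f' : rest u f u' f' = rest u' f' u f.
Proof. by apply: bop_eq => // h w; rewrite /rest /polar ?opE ?linE; ring. Qed.

Lemma rest_comml u f u' f' : rest u f u' f' * rank1 u f = rank1 u f * rest u f u' f'.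
Proof.
have [c cE] := dP u f; have := polar_comm2 (rank1 u f) (rank1 u' f').
have -> : q (rank1 u f) (rank1 u f) = c *: (1 : A) + d u f *: rank1 u f.
  by rewrite -cE subrK.
set P := polar _ _ => e; apply/eqP; rewrite -subr_eq0 -e; apply/eqP.
by apply: bop_eq => // h w; rewrite /rest -/P ?opE ?linE; ring.
Qed.

Lemma rest_commr u f u' f' : rest u f u' f' * rank1 u' f' = rank1 u' f' * rest u f u' f'.
Proof. by rewrite restC rest_comml. Qed.

Lemma rest_linear1 u' f f' : linear (fun u => rest u f u' f').
Proof.
move=> a u v; rewrite /rest /polar !rank1Dl// !rank1Zl// !qE !dE.
by apply: bop_eq => // h w; rewrite ?opE ?linE; ring.
Qed.

Lemma rest_linear2 u u' f' : linear (fun f => rest u f u' f').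
Proof.
move=> a f g; rewrite /rest /polar !rank1Dr// !rank1Zr// !qE !dE.
by apply: bop_eq => // h w; rewrite ?opE ?linE; ring.
Qed.

Lemma rest_linear3 u f f' : linear (fun u' => rest u f u' f').
Proof. by move=> a u' v'; rewrite !(restC u); exact: rest_linear1. Qed.

Lemma rest_linear4 u f u' : linear (fun f' => rest u f u' f').
Proof. by move=> a f' g'; rewrite !(restC u); exact: rest_linear2. Qed.

(* With [r = rank1 u f], [s = rank1 u' f'] and [tr] the trace, this is
   [r s + s r - tr r s - tr s r], the value of [rest] for [q x x = x^2]. *)
Definition model u (f : D) u' (f' : D) : A := (f u' : K) *: rank1 u f' +
  (f' u : K) *: rank1 u' f - (f u : K) *: rank1 u' f' - (f' u' : K) *: rank1 u f.

Lemma modelC u f u' f' : model u f u' f' = model u' f' u f.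
Proof. by apply: bop_eq => // h w; rewrite /model ?opE ?linE; ring. Qed.

Lemma model_linear1 u' f f' : linear (fun u => model u f u' f').
Proof. by move=> a u v; apply: bop_eq => // h w; rewrite /model ?opE ?linE; ring. Qed.

Lemma model_linear2 u u' f' : linear (fun f => model u f u' f').
Proof. by move=> a f g; apply: bop_eq => // h w; rewrite /model ?opE ?linE; ring. Qed.

Lemma model_linear3 u f f' : linear (fun u' => model u f u' f').
Proof. by move=> a u' v'; rewrite !(modelC u); exact: model_linear1. Qed.

Lemma model_linear4 u f u' : linear (fun f' => model u f u' f').
Proof. by move=> a f' g'; rewrite !(modelC u); exact: model_linear2. Qed.

Lemma commute_rank1_eigen (a : A) u (f : D) x : a * rank1 u f = rank1 u f * a ->
  f x = 1 :> K -> a u = (f (a x) : K) *: u.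
Proof.
move=> ar fx; have := congr1 (fun T : A => T x) ar.
by rewrite ?opE fx scale1r.
Qed.

(** Commutation with the two rank one operators makes [u] and [u'] eigenvectors. Replacing [u'] by
    [u + u'] adds only a scalar to the operator, so [u + u'] is an eigenvector too and the
    eigenvalues agree. *)
Lemma rest_eigen u u' (f f' : D) : indep2 u u' -> f != 0 -> f' != 0 ->
  exists e, rest u f u' f' u = e *: u /\ rest u f u' f' u' = e *: u'.
Proof.
move=> uu' /dual_neq0P[x fx] /dual_neq0P[x' f'x'].
have e1 := commute_rank1_eigen (rest_comml u f u' f') fx.
have e2 := commute_rank1_eigen (rest_commr u f u' f') f'x'.
have e3 := commute_rank1_eigen (rest_commr u f (u + u') f') f'x'.
have [c cE] : is_scalar (rest u f u f') := dPr u f f'.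
move: e3; rewrite (linear_add (rest_linear3 u f f')) cE.
set R := rest _ _ _ _ in e1 e2 *; set e := f' _ => e3.
clearbody R e.
exists (f (R x)); split=> //; rewrite e2; congr (_ *: _).
have [|h1 h2] := @indep2_eq _ _ u u' (c + f (R x) : K) (c + f' (R x') : K) e e uu'.
  apply: (dual_eq sepX) => g; have := congr1 (fun y => g y : K) e3.
  rewrite ?opE ?linE e1 e2 ?linE => /eqP; rewrite -subr_eq0 => /eqP E.
  by rewrite -[RHS]addr0 -E; ring.
by move: h2; rewrite -h1 => /addrI.
Qed.

(** * The remainder in dimension at least three *)

Section DimensionAtLeastThree.
Hypothesis X3 : has_dim3 X.

Lemma rest_kernel_image u (f : D) u' (f' : D) : exists c,
  (forall w, f w = 0 :> K -> f' w = 0 :> K -> rest u f u' f' w = c *: w) /\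
  (forall v, exists b b', rest u f u' f' v = c *: v + (b *: u + b' *: u')).
Proof.
have [w0 [w00 fw0 f'w0]] := dual_kernel2_neq0 f f' X3; have [v0 v0P] := X3 u u'.
apply: (scalar_kernel_image sepX w00 fw0 f'w0 v0P) => v h w fw f'w.
set r := rank1 u f; set s := rank1 u' f'; set t := rank1 v h.
have := congr1 (fun T : A => T w) (polar_comm3 r s t); rewrite /rest -/r -/s.
set P := polar r s; set P1 := polar s t; set P2 := polar t r.
clearbody P P1 P2 => H.
(* The first terms come from the commutators of [P1] with [r] and of [P2] with [s]; the others come
   from the multiples of [r] and [s] subtracted in [rest]. *)
exists ((f (P1 w) : K) - d u' f' * f v * h w), ((f' (P2 w) : K) - d u f * f' v * h w).
move: H; rewrite ?opE ?linE fw f'w => E; apply: (dual_eq sepX) => g.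
have := congr1 (fun y => g y : K) E; rewrite ?opE ?linE => {}E.
by rewrite ?opE ?linE !(mul0r, mulr0, subr0) -[RHS]addr0 -E; ring.
Qed.

(* For the matrices [M] with rows [(al, ga)], [(be, de)] and [G] with rows
   [(p, s)], [(q', t)]: if [M G = a] is scalar, [G M] is diagonal and the first
   column of [G] is nonzero, then [M] is a multiple of the adjugate of [G]. *)
Lemma adjugate_of_scalar_products (p q' s t al be ga de a : K) :
  (p != 0) || (q' != 0) -> p * al + q' * ga = a -> p * be + q' * de = 0 ->
  s * al + t * ga = 0 -> s * be + t * de = a ->
  ga * p + de * s = 0 -> al * q' + be * t = 0 ->
  exists l, [/\ al = - l * t, be = l * q', ga = l * s & de = - l * p].
Proof.
move=> pq h1 h2 h3 h4 h5 h6; have [p0|p0] := eqVneq p 0; last first.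
  (* The factor is read off from [de = - l * p]; when [p = 0] it is read off from [be = l * q']. *)
  exists (- (de / p)).
  have e2 : be = - (de / p) * q'.
    by apply: (mulfI p0); rewrite -[LHS]subr0 -h2; field.
  have e3 : ga = - (de / p) * s.
    by apply: (mulIf p0); rewrite -[LHS]subr0 -h5; field.
  have e4 : de = - - (de / p) * p by field.
  split=> //; apply: (mulfI p0); apply: (addIr (q' * ga)); rewrite h1 -h4 e2 e3.
  by field.
have q0 : q' != 0 by move: pq; rewrite p0 eqxx.
have de0 : de = 0 by apply: (mulfI q0); rewrite mulr0 -h2 p0; ring.
exists (be / q').
have e1 : al = - (be / q') * t.
  by apply: (mulIf q0); rewrite -[LHS]subr0 -h6; field.
split=> //; first by field.
- by apply: (mulfI q0); apply: (addrI (p * al)); rewrite h1 -h4 de0 p0; field.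
- by rewrite de0 p0 mulr0.
Qed.

(** Minus a scalar, [rest] is a combination of the four operators built from [u], [u'] and [f],
    [f']. The eigenvector and commutation relations are the hypotheses of
    [adjugate_of_scalar_products], with [G] the matrix of values of [f] and [f'] at [u] and [u'];
    its adjugate carries the coefficients of [model]. *)
Lemma rest_local u (f : D) u' (f' : D) : indep2 u u' -> indep2 f f' ->
  (f u != 0 :> K) || (f' u != 0 :> K) ->
  exists l, is_scalar (rest u f u' f' - l *: model u f u' f').
Proof.
move=> uu' ff' fu0; have u0 := indep2_neq0l uu'.
have u'0 := indep2_neq0l (indep2C uu').
have f0 := indep2_neq0l ff'; have f'0 := indep2_neq0l (indep2C ff').
have [c [Rc RI]] := rest_kernel_image u f u' f'.
have [e [Ru Ru']] := rest_eigen uu' f0 f'0.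
have comml := rest_comml u f u' f'; have commr := rest_commr u f u' f'.
move: (rest u f u' f') Rc RI Ru Ru' comml commr => R Rc RI Ru Ru' comml commr.
have [w1 [w2 [e11 e21 e12 e22]]] := dual_basis ff'.
have [al [be Rw1]] := RI w1; have [ga [de Rw2]] := RI w2.
have Rw w : R w = c *: w + ((f w * al + f' w * ga : K) *: u +
    (f w * be + f' w * de : K) *: u').
  have := Rc (w - (f w : K) *: w1 - (f' w : K) *: w2).
  rewrite ?linE e11 e21 e12 e22 !mulr0 !mulr1 !subr0 !subrr => /(_ erefl erefl) E.
  apply: (dual_eq sepX) => g; move: (congr1 (fun y => g y : K) E).
  rewrite Rw1 Rw2 ?linE => /eqP; rewrite -subr_eq0 => /eqP {}E.
  by rewrite -[RHS]addr0 -E; ring.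
have [ea eb] : f u * al + f' u * ga = e - c :> K /\ f u * be + f' u * de = 0 :> K.
  apply: (indep2_eq uu'); rewrite scale0r addr0 scalerBl -Ru Rw.
  by rewrite [RHS]addrC addKr.
have [ec ed] : f u' * al + f' u' * ga = 0 :> K /\ f u' * be + f' u' * de = e - c :> K.
  apply: (indep2_eq uu'); rewrite scale0r add0r scalerBl -Ru' Rw.
  by rewrite [RHS]addrC addKr.
(* Commutation with [rank1 u f], which kills [w2], gives [f (R w2) = 0]. *)
have ee : ga * f u + de * f u' = 0 :> K.
  have := congr1 (fun T : A => T w2) comml; rewrite ?opE e12 scale0r bop0 Rw.
  move=> /esym/eqP; rewrite scaler_eq0 (negPf u0) orbF ?linE e12 e22 => /eqP <-.
  ring.
have eg : al * f' u + be * f' u' = 0 :> K.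
  have := congr1 (fun T : A => T w1) commr; rewrite ?opE e21 scale0r bop0 Rw.
  move=> /esym/eqP; rewrite scaler_eq0 (negPf u'0) orbF ?linE e11 e21 => /eqP <-.
  ring.
have [l [al_l be_l ga_l de_l]] := adjugate_of_scalar_products fu0 ea eb ec ed ee eg.
exists l, c; apply: bop_ext => w; apply: (dual_eq sepX) => g.
by rewrite /model ?opE Rw al_l be_l ga_l de_l ?linE; ring.
Qed.

(** A common zero of [f] and [f'] forces the scalar to be 0; the values at a dual basis are then
    linear relations between [u] and [u']. This is the kernel condition of
    [alternating_proportional]. *)
Lemma model_scalar u (f : D) u' (f' : D) : indep2 f f' ->
  (f u != 0 :> K) || (f' u != 0 :> K) -> is_scalar (model u f u' f') ->
  exists a, u' = a *: u.
Proof.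
move=> ff' fu0 [c cE]; have [w [w0 fw f'w]] := dual_kernel2_neq0 f f' X3.
have c0 : c = 0.
  have := congr1 (fun T : A => T w) cE; rewrite /model ?opE fw f'w !scale0r !scaler0.
  rewrite addr0 !subr0 => /esym/eqP.
  by rewrite scaler_eq0 (negPf w0) orbF => /eqP.
have [w1 [w2 [e11 e21 e12 e22]]] := dual_basis ff'.
have E1 := congr1 (fun T : A => T w1) cE; have E2 := congr1 (fun T : A => T w2) cE.
move: E1 E2; rewrite /model ?opE e11 e21 e12 e22 c0 !scale0r !scale1r !scaler0.
rewrite add0r !subr0 addr0 => /eqP; rewrite subr_eq0 => /eqP E1 /eqP.
rewrite subr_eq0 => /eqP E2.
case/orP: fu0 => nz.
  exists ((f u : K)^-1 * f u'); rewrite -scalerA E2 scalerA mulVf ?scale1r//.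
exists ((f' u : K)^-1 * f' u'); rewrite -scalerA -E1 scalerA mulVf ?scale1r//.
Qed.

Lemma rest_proportional : exists l, forall u f u' f',
  is_scalar (rest u f u' f' - l *: model u f u' f').
Proof.
have [e0 e00] := has_dim2_neq0 X2; have [g0 g0e] := dual_normalized sepX e00.
pose pi := mod_scalar e0 g0.
have pil : linear pi by exact: mod_scalar_linear.
have pi0 a : pi a = 0 <-> is_scalar a by exact: mod_scalar_eq0.
have piP a l b : pi a = l *: pi b <-> is_scalar (a - l *: b).
  by rewrite -(linear_scale pil); exact: mod_scalarP.
have pi_lin (V : lmodType K) (F : V -> A) : linear F -> linear (fun x => pi (F x)).
  by move=> Fl a x y; rewrite Fl pil.
have mod0 u f f' : model u f u f' = 0.
  by apply: (bop_eq sepX) => h w; rewrite /model ?opE ?linE; ring.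
have mod0' u u' f : model u f u' f = 0.
  by apply: (bop_eq sepX) => h w; rewrite /model ?opE ?linE; ring.
have pi00 : pi 0 = 0 := linear_zero pil.
have indepP f f' : indep2 f f' -> exists l, forall u u',
    pi (rest u f u' f') = l *: pi (model u f u' f').
  move=> ff'; have [w1 [w2 [e11 e21 e12 e22]]] := dual_basis ff'.
  apply: (@alternating_proportional K X A (fun u u' => pi (rest u f u' f'))
    (fun u u' => pi (model u f u' f'))
    (fun u => (f u != 0 :> K) || (f' u != 0 :> K)) w1) => //.
  - by move=> u; exact: (pi_lin _ _ (rest_linear3 u f f')).
  - by move=> u'; exact: (pi_lin _ _ (rest_linear1 u' f f')).
  - by move=> u; apply/pi0; exact: dPr.
  - by move=> u; exact: (pi_lin _ _ (model_linear3 u f f')).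
  - by move=> u'; exact: (pi_lin _ _ (model_linear1 u' f f')).
  - by move=> u; rewrite mod0.
  - by rewrite e11 oner_eq0.
  - move=> u; have [fu|] := eqVneq (f u : K) 0; last by left.
    by right; rewrite dualD fu add0r e11 oner_eq0.
  - by move=> u u' fu0 /pi0; exact: model_scalar.
  move=> u u' fu0; have [[a ->]|nu'] := pselect (exists a, u' = a *: u).
    exists 0; rewrite scale0r; have -> : rest u f (a *: u) f' = a *: rest u f u f'.
      exact: (linear_scale (rest_linear3 u f f')).
    rewrite (linear_scale pil); have /pi0 -> : is_scalar (rest u f u f') := dPr u f f'.
    by rewrite scaler0.
  have uu' : indep2 u u'.
    apply: indep2P => [|a u'a]; last by apply: nu'; exists a.
    by apply: contraTneq fu0 => ->; rewrite !dual0 eqxx.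
  by have [l lP] := rest_local uu' ff' fu0; exists l; apply/piP.
have D3 := has_dim3_dual sepX X3; have [f0 f00] := has_dim2_neq0 (has_dim2_dual sepX X2).
pose S f f' : X -> X -> A := fun u u' => pi (rest u f u' f').
pose T f f' : X -> X -> A := fun u u' => pi (model u f u' f').
have S0 u u' f : pi (rest u f u' f) = 0 by apply/pi0; exact: dPl.
(* Here the alternating maps take functions of [u] and [u'] as values, so the factor becomes
   independent of vectors and functionals together. *)
have [l lP] : exists l, forall f f', S f f' = l *: T f f'.
  apply: (@alternating_proportional K D (X -> X -> A : lmodType K) S T
    (fun f => f != 0) f0) => //.
  - move=> f a g g'; apply/funext => u; apply/funext => u'.
    exact: (pi_lin _ _ (rest_linear4 u f u')).
  - move=> f a g g'; apply/funext => u; apply/funext => u'.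
    exact: (pi_lin _ _ (rest_linear2 u u' f)).
  - by move=> f; apply/funext => u; apply/funext => u'; exact: S0.
  - move=> f a g g'; apply/funext => u; apply/funext => u'.
    exact: (pi_lin _ _ (model_linear4 u f u')).
  - move=> f a g g'; apply/funext => u; apply/funext => u'.
    exact: (pi_lin _ _ (model_linear2 u u' f)).
  - by move=> f; apply/funext => u; apply/funext => u'; rewrite /T mod0'.
  - by move=> f; have [->|] := eqVneq f 0; [right; rewrite add0r | left].
  - move=> f f' f_neq0 Tff'; apply: contrapT => nf'.
    have ff' : indep2 f f' by apply: indep2P => // a f'a; apply: nf'; exists a.
    have [w1 [w2 [e11 e21 e12 e22]]] := dual_basis ff'.
    have := congr1 (fun F : X -> X -> A => F w1 w2) Tff' => /pi0/(model_scalar ff').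
    rewrite e11 oner_eq0 => /(_ isT)[a w2a].
    by move: e22; rewrite w2a dualZ e21 mulr0 => /esym/eqP; rewrite oner_eq0.
  move=> f f' f_neq0; have [[a ->]|nf'] := pselect (exists a, f' = a *: f).
    exists 0; rewrite scale0r; apply/funext => u; apply/funext => u'.
    rewrite /S; have -> : rest u f u' (a *: f) = a *: rest u f u' f.
      exact: (linear_scale (rest_linear4 u f u')).
    by rewrite (linear_scale pil) S0 scaler0.
  have ff' : indep2 f f' by apply: indep2P => // a f'a; apply: nf'; exists a.
  have [l lP] := indepP _ _ ff'; exists l.
  by apply/funext => u; apply/funext => u'; exact: lP.
exists l => u f u' f'; apply/piP.
exact: (congr1 (fun F : X -> X -> A => F u u') (lP f f')).
Qed.

End DimensionAtLeastThree.

(** Two vectors [u0], [v0] span [X]. Modulo scalars [rest] alternates in the vectors, so only this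
    pair matters, and a common eigenvalue on a spanning pair makes the operator scalar. *)
Lemma rest_scalar_dim2 : ~ has_dim3 X -> forall u f u' f', is_scalar (rest u f u' f').
Proof.
move=> nX3; have [e0 e00] := has_dim2_neq0 X2; have [g0 g0e] := dual_normalized sepX e00.
pose pi := mod_scalar e0 g0.
have pil : linear pi by exact: mod_scalar_linear.
have pi0 a : pi a = 0 <-> is_scalar a by exact: mod_scalar_eq0.
have [u0 [v0 uv0]] : exists u0 v0 : X, forall w, exists a b, w = a *: u0 + b *: v0.
  apply: contrapT => nuv; apply: nX3 => u v; apply: contrapT => nw; apply: nuv.
  exists u, v => w; apply: contrapT => nab; apply: nw; exists w => a b wab.
  by apply: nab; exists a, b.
move=> u f u' f'.
have base : pi (rest u0 f v0 f') = 0.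
  have [->|f0] := eqVneq f 0; first by
    rewrite (linear_zero (rest_linear2 u0 v0 f')) (linear_zero pil).
  have [->|f'0] := eqVneq f' 0; first by
    rewrite (linear_zero (rest_linear4 u0 f v0)) (linear_zero pil).
  have [->|u00] := eqVneq u0 0; first by
    rewrite (linear_zero (rest_linear1 v0 f f')) (linear_zero pil).
  have [[a ->]|nv0] := pselect (exists a, v0 = a *: u0).
    rewrite (linear_scale (rest_linear3 u0 f f')) (linear_scale pil).
    by have /pi0 -> : is_scalar (rest u0 f u0 f') := dPr u0 f f'; rewrite scaler0.
  have uv : indep2 u0 v0 by apply: indep2P => // a va; apply: nv0; exists a.
  have [e [Ru Rv]] := rest_eigen uv f0 f'0; apply/pi0; exists e.
  apply: bop_ext => w; have [a [b ->]] := uv0 w.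
  rewrite !bopD !bopZ Ru Rv; apply: (dual_eq sepX) => g.
  by rewrite ?opE ?linE; ring.
have base' : pi (rest v0 f u0 f') = 0.
  have /pi0 E : is_scalar (rest (u0 + v0) f (u0 + v0) f') := dPr _ _ _.
  have /pi0 E1 : is_scalar (rest u0 f u0 f') := dPr _ _ _.
  have /pi0 E2 : is_scalar (rest v0 f v0 f') := dPr _ _ _.
  move: E; rewrite (linear_add (rest_linear1 _ f f')) !(linear_add (rest_linear3 _ f f')).
  move: (rest u0 f u0 f') (rest u0 f v0 f') (rest v0 f u0 f') (rest v0 f v0 f') E1 E2 (base).
  by move=> R1 R2 R3 R4 E1 E2 E3; rewrite !(linear_add pil) E1 E2 E3 !add0r addr0.
have [a [b ->]] := uv0 u; have [a' [b' ->]] := uv0 u'.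
have /pi0 E1 : is_scalar (rest u0 f u0 f') := dPr _ _ _.
have /pi0 E2 : is_scalar (rest v0 f v0 f') := dPr _ _ _.
apply/pi0; rewrite (linear_add (rest_linear1 _ f f')) !(linear_scale (rest_linear1 _ f f')).
rewrite !(linear_add (rest_linear3 _ f f')) !(linear_scale (rest_linear3 _ f f')).
move: (rest u0 f u0 f') (rest u0 f v0 f') (rest v0 f u0 f') (rest v0 f v0 f') E1 E2 base base'.
move=> R1 R2 R3 R4 E1 E2 E3 E4.
rewrite !(linear_add pil, linear_scale pil) E1 E2 E3 E4.
by rewrite !(scaler0, addr0).
Qed.

(** * From rank one operators to all operators *)

Lemma polar_rank1_form : exists l (m : X -> D -> K),
  [/\ forall u, linear (m u : D -> K^o), forall f, linear (m ^~ f : X -> K^o) &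
    forall u f u' f', is_scalar (polar (rank1 u f) (rank1 u' f')
      - l *: (rank1 u f * rank1 u' f' + rank1 u' f' * rank1 u f)
      - m u f *: rank1 u' f' - m u' f' *: rank1 u f)].
Proof.
have [X3|nX3] := pselect (has_dim3 X).
  (* The term [l * f u] absorbs the trace terms of [model]. *)
  have [l lP] := rest_proportional X3; exists l, (fun u f => d u f - l * f u); split.
  - move=> u a f g; rewrite dDr dZr ?opE; set x := d u f; set y := d u g.
    by rewrite -[a *: _]/(a * _ : K); ring.
  - move=> f a u v; rewrite dDl dZl ?linE; set x := d u f; set y := d v f.
    by rewrite -[a *: _]/(a * _ : K); ring.
  move=> u f u' f'; have [c cE] := lP u f u' f'; exists c; rewrite -cE /rest.
  move: (polar _ _) => P.
  by apply: (bop_eq sepX) => h w; rewrite /model ?opE ?linE; ring.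
exists 0, d; split=> // u f u' f'; rewrite scale0r subr0.
exact: rest_scalar_dim2.
Qed.

Lemma trace_form : exists l (t : A -> K), linear (t : A -> K^o) /\
  forall x, is_scalar (q x x - l *: (x * x) - t x *: x).
Proof.
have [l [m [mr ml mP]]] := polar_rank1_form.
have [e0 e00] := has_dim2_neq0 X2; have [g0 g0e] := dual_normalized sepX e00.
pose pi := mod_scalar e0 g0.
have pil : linear pi by exact: mod_scalar_linear.
have pi0 a : pi a = 0 <-> is_scalar a by exact: mod_scalar_eq0.
have piP a k b : pi a = k *: pi b <-> is_scalar (a - k *: b).
  by rewrite -(linear_scale pil); exact: mod_scalarP.
have pi_lin (V : lmodType K) (F : V -> A) : linear F -> linear (fun x => pi (F x)).
  by move=> Fl a x y; rewrite Fl pil.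
have pi_rank1 u f : u != 0 -> f != 0 -> pi (rank1 u f) != 0.
  move=> u0 f0; apply/eqP => /pi0/(rank1_scalar_eq0 X2)[] /eqP.
    by rewrite (negPf u0).
  by rewrite (negPf f0).
have mDl u v f : m (u + v) f = m u f + m v f by exact: (linear_add (ml f)).
have mZl a u f : m (a *: u) f = a * m u f by exact: (linear_scale (ml f)).
have mDr u f g : m u (f + g) = m u f + m u g by exact: (linear_add (mr u)).
have mZr a u f : m u (a *: f) = a * m u f by exact: (linear_scale (mr u)).
pose C x u f : A := polar x (rank1 u f) - l *: (x * rank1 u f + rank1 u f * x)
  - m u f *: x.
have Cx u f : linear (fun x => C x u f).
  move=> a x y; rewrite /C /polar !qE.
  by apply: (bop_eq sepX) => h w; rewrite ?opE ?linE; ring.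
have Cu x f : linear (fun u => C x u f).
  move=> a u v; rewrite /C /polar !rank1Dl// !rank1Zl// !qE mDl mZl.
  by apply: (bop_eq sepX) => h w; rewrite ?opE ?linE; ring.
have Cf x u : linear (fun f => C x u f).
  move=> a f g; rewrite /C /polar !rank1Dr// !rank1Zr// !qE mDr mZr.
  by apply: (bop_eq sepX) => h w; rewrite ?opE ?linE; ring.
(* By [polar_comm3] the commutator of [C x u f] with another rank one operator has the form required
   by [scalar_plus_rank1]. *)
have C_comm x u f v h : C x u f * rank1 v h - rank1 v h * C x u f =
    (- C x v h) * rank1 u f - rank1 u f * (- C x v h).
  have [c cE] := mP u f v h; have := polar_comm3 (rank1 u f) (rank1 v h) x.
  have -> : polar (rank1 v h) x = polar x (rank1 v h) by rewrite /polar addrC.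
  have -> : polar (rank1 u f) (rank1 v h) = c *: (1 : A) + m v h *: rank1 u f
      + m u f *: rank1 v h + l *: (rank1 u f * rank1 v h + rank1 v h * rank1 u f).
    by rewrite -cE !subrK.
  rewrite /C; move: (polar _ _) (polar _ _) => P1 P2 E.
  apply/eqP; rewrite -subr_eq0 -E; apply/eqP.
  by apply: (bop_eq sepX) => g w; rewrite ?opE ?linE; ring.
have C_loc x u f : exists t, pi (C x u f) = t *: pi (rank1 u f).
  have [->|u0] := eqVneq u 0.
    by exists 0; rewrite (linear_zero (Cu x f)) (linear_zero pil) scale0r.
  have [->|f0] := eqVneq f 0.
    by exists 0; rewrite (linear_zero (Cf x u)) (linear_zero pil) scale0r.
  have [|t tP] := @scalar_plus_rank1 K X sepX (C x u f) u f X2 u0 f0.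
    by move=> v h; exists (- C x v h); exact: C_comm.
  by exists t; apply/piP.
have D2 := has_dim2_dual sepX X2; have [f0 f00] := has_dim2_neq0 D2.
(* The factor is made independent of [f] at [u = e0], then of [u] for each [f]; the two constants
   are compared at [rank1 e0 f]. *)
have C_glob x : exists t, forall u f, pi (C x u f) = t *: pi (rank1 u f).
  have [v0 ev] := has_dim2_indep2 X2 e00; have [h0 fh] := has_dim2_indep2 D2 f00.
  have [t tP] : exists t, forall f, pi (C x e0 f) = t *: pi (rank1 e0 f).
    apply: (@locally_proportional K D A (fun f => pi (C x e0 f))
      (fun f => pi (rank1 e0 f)) f0 h0) => //.
    - exact: (pi_lin _ _ (Cf x e0)).
    - by apply: pi_lin => a f g; rewrite rank1Dr// rank1Zr.
    - move=> a b; rewrite -!(linear_scale pil) -(linear_add pil) -!rank1Zr//.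
      rewrite -rank1Dr// => E; apply: fh; apply: contrapT => /eqP /(pi_rank1 _ _ e00).
      by rewrite E eqxx.
  exists t => u f; have [->|f_neq0] := eqVneq f 0.
    by rewrite (linear_zero (Cf x u)) rank10r// (linear_zero pil) scaler0.
  have [t' t'P] : exists t', forall u, pi (C x u f) = t' *: pi (rank1 u f).
    apply: (@locally_proportional K X A (fun u => pi (C x u f))
      (fun u => pi (rank1 u f)) e0 v0) => //.
    - exact: (pi_lin _ _ (Cu x f)).
    - by apply: pi_lin => a v w; rewrite rank1Dl// rank1Zl.
    - move=> a b; rewrite -!(linear_scale pil) -(linear_add pil) -!rank1Zl//.
      rewrite -rank1Dl// => E; apply: ev; apply: contrapT => /eqP v_neq0.
      by have := pi_rank1 _ _ v_neq0 f_neq0; rewrite E eqxx.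
  rewrite t'P; congr (_ *: _); have := tP f; rewrite t'P => /eqP.
  rewrite -subr_eq0 -scalerBl scaler_eq0 (negPf (pi_rank1 _ _ e00 f_neq0)) orbF.
  by rewrite subr_eq0 => /eqP.
have [t tP] : exists t : A -> K, forall x u f, pi (C x u f) = t x *: pi (rank1 u f).
  by exists (fun x => sval (cid (C_glob x))) => x; exact: svalP (cid (C_glob x)).
have tl : linear (t : A -> K^o).
  move=> a x y; have r0 := pi_rank1 _ _ e00 f00.
  have := tP (a *: x + y) e0 f0; rewrite (pi_lin _ _ (Cx e0 f0)) !tP.
  rewrite scalerA -scalerDl => /eqP; rewrite -subr_eq0 -scalerBl scaler_eq0.
  by rewrite (negPf r0) orbF subr_eq0 => /eqP <-.
exists l, t; split=> // x; apply: (commute_rank1_scalar sepX) => u f.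
have [c cE] : is_scalar (C x u f - t x *: rank1 u f) by apply/piP; exact: tP.
(* With this form of the polar, its commutator with [x] is that of [rank1 u f] with
   [l *: (x * x) + t x *: x]. *)
have := polar_comm2 x (rank1 u f).
have -> : polar x (rank1 u f) = c *: (1 : A) + t x *: rank1 u f + m u f *: x
    + l *: (x * rank1 u f + rank1 u f * x).
  by rewrite -cE /C !subrK.
move=> E; apply/eqP; rewrite -subr_eq0 -E; apply/eqP.
by apply: (bop_eq sepX) => h w; rewrite ?opE ?linE; ring.
Qed.

End CommutingTrace.

(** * Properness of commuting traces *)

Section Proper.
Variables (K : numFieldType) (X : normedModType K).
Local Notation A := (boundedOp X).

Lemma scalar_center (a : A) : is_scalar a -> a \in Defs.center A.
Proof.
move=> [c ->]; apply/asboolP => b; apply: bop_ext => w.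
by rewrite ?opE ?linE.
Qed.

Lemma bop_commutative : ~ has_dim2 X -> forall S T : A, S * T = T * S.
Proof.
move=> nX2 S T.
have [u uP] : exists u : X, forall w, exists a, w = a *: u.
  apply: contrapT => nu; apply: nX2 => u; apply: contrapT => nw; apply: nu.
  exists u => w; apply: contrapT => na; apply: nw; exists w => a wa.
  by apply: na; exists a.
have [s Su] := uP (S u); have [t Tu] := uP (T u).
apply: bop_ext => w; have [a ->] := uP w.
by rewrite ?opE ?linE Su Tu ?linE Su Tu !scalerA; congr (_ *: _); ring.
Qed.

Lemma commuting_trace_proper (q : {bilinear A -> A -> A}) : separating_dual X ->
  commuting (trace q) -> proper_trace (trace q).
Proof.
move=> sepX q_comm.
have qr x : linear (q x) by move=> a y z; exact: linearPr.
have ql y : linear (q ^~ y) by move=> a x z; exact: linearPl.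
have [X2|nX2] := pselect (has_dim2 X); last first.
  have comm := bop_commutative nX2.
  have c_all z : z \in Defs.center A by apply/asboolP => y; exact: comm.
  exists 0, \0, q; split=> // x.
  by rewrite !mul0r !add0r.
have {}q_comm x : q x x * x = x * q x x.
  by apply/eqP; rewrite -subr_eq0; apply/eqP; exact: q_comm.
have [d [dr dl dP dPl dPr]] := trace_rank1_coef sepX qr ql q_comm X2.
have [l [t [tl tP]]] := trace_form sepX qr ql q_comm X2 dr dl dP dPl dPr.
have tD x y : t (x + y) = t x + t y by exact: (linear_add tl).
have tZ a x : t (a *: x) = a * t x by exact: (linear_scale tl).
pose mu_fun x : A := t x *: (1 : A).
have mu_lin : linear mu_fun.
  by move=> a x y; rewrite /mu_fun tD tZ scalerDl scalerA.
(* The symmetric bilinear map whose trace is [q x x - l *: (x * x) - t x *: x]. Its values are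
   scalar by polarising this scalar-valued trace. *)
pose p_fun x y : A := 2^-1 *: (q x y + q y x - l *: (x * y + y * x)
  - t x *: y - t y *: x).
have pC x y : p_fun x y = p_fun y x.
  apply: (bop_eq sepX) => h w; rewrite /p_fun.
  by move: (q x y) (q y x) => a b; rewrite ?opE ?linE; ring.
have pr x : linear (p_fun x).
  move=> a y z; rewrite /p_fun qr ql tD tZ.
  by apply: (bop_eq sepX) => h w; rewrite ?opE ?linE; ring.
have pl y : linear (p_fun ^~ y).
  by move=> a x z; rewrite !(pC _ y); exact: pr.
pose mu : {linear A -> A} := HB.pack mu_fun
  (GRing.isLinear.Build K A A *:%R mu_fun mu_lin).
pose p : {bilinear A -> A -> A} := HB.pack p_fun
  (bilinear_isBilinear.Build K A A A *:%R *:%R p_fun (pl, pr)).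
exists (l *: (1 : A)), mu, p; split.
- by apply: scalar_center; exists l.
- by move=> x; apply: scalar_center; exists (t x).
- move=> x y; apply: scalar_center.
  have [c1 E1] := tP (x + y); have [c2 E2] := tP x; have [c3 E3] := tP y.
  exists (2^-1 * (c1 - c2 - c3)); rewrite -scalerA !scalerBl -E1 -E2 -E3.
  rewrite tD (linear_add (qr _)) !(linear_add (ql _)).
  rewrite [LHS]/(p_fun x y) /p_fun; congr (_ *: _).
  move: (q x x) (q x y) (q y x) (q y y) => a b c e.
  by apply: (bop_eq sepX) => h w; rewrite ?opE ?linE; ring.
move=> x; rewrite /trace -[p x x]/(p_fun x x) -[mu x]/(mu_fun x) /p_fun /mu_fun.
move: (q x x) => a; rewrite expr2; apply: (bop_eq sepX) => h w.
by rewrite ?opE ?linE; field.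
Qed.

End Proper.

Theorem corollary3p21 (R : realType) :
  (forall (X : completeNormedModType R) (q : {bilinear boundedOp X -> boundedOp X -> boundedOp X}),
     commuting (trace q) -> proper_trace (trace q)) /\
  (forall (X : completeNormedModType R[i]) (q : {bilinear boundedOp X -> boundedOp X -> boundedOp X}),
     commuting (trace q) -> proper_trace (trace q)).
Proof.
split=> X q; apply: commuting_trace_proper.
- exact: separating_dual_real.
- exact: separating_dual_complex.
Qed.
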